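(* Let $\kappa>0$. If the Markov generator $L$ satisfies $CD_\Upsilon(\kappa,\infty)$, $M_1\in\ell^2(\mu)$ and $M_2\in\ell^1(\mu)$, then $L$ satisfies the modified logarithmic Sobolev inequality $\mathrm{MLSI}(\kappa)$, i.e. $$\mathcal{H}(f)\le\frac{1}{2\kappa}\,\mathcal{I}(f)$$ for every $f\in\mathcal{P}_*(X)$ with $\mathcal{H}(f)<\infty$. In particular, for every $f\in\mathcal{P}_*^+(X)$, $$\mathcal{H}(P_tf)\le e^{-2\kappa t}\,\mathcal{H}(f),\qquad t>0.$$
   Context: Setting. $X$ is a finite or countably infinite set and $k:X\times X\to\mathbb{R}$ are transition rates of a continuous-time Markov chain $(Z_t)_{t\ge0}$ on $X$: $k(x,y)\ge 0$ for $x\neq y$ and $k(x,x)=-\sum_{y\neq x}k(x,y)<0$. The generator is $Lf(x)=\sum_{y\in X}k(x,y)(f(y)-f(x))$. Standing assumptions: the chain is irreducible (for all $x,y\in X$ there are $x=z_1,\dots,z_m=y$, $m\ge2$, with $k(z_i,z_{i+1})>0$); its invariant measure, unique up to positive multiples, can be normalized to a probability measure $\mu$ with density $\pi:X\to(0,\infty)$ with respect to counting measure; detailed balance $\pi(x)k(x,y)=\pi(y)k(y,x)$ holds; for every $x\in X$, $$M_1(x):=\sum_{y\neq x}k(x,y)<\infty,\qquad M_2(x):=\sum_{y\neq x}k(x,y)\sum_{z\neq y}k(y,z)<\infty;$$ and the semigroup $P_tf(x)=\mathbb{E}(f(Z_t)\mid Z_0=x)$ is Markov, i.e. $P_t1=1$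 (the chain is non-explosive). Function classes. $\ell^\infty(X)$: bounded real functions on $X$; $\ell^p(\mu)$: $p$-summable functions with respect to $\mu$. $\mathcal{P}_*(X)$ is the set of $f:X\to(0,\infty)$ with $\sum_xf(x)\pi(x)=1$, and $\mathcal{P}_*^+(X)$ is the set of those $f\in\mathcal{P}_*(X)$ that are bounded and satisfy $\inf_Xf>0$. Entropy and Fisher information. $\mathcal{H}(\rho)=\sum_x\rho(x)\log(\rho(x))\pi(x)$ (value $\infty$ allowed) and, for $\rho\in\mathcal{P}_*(X)$, $$\mathcal{I}(\rho)=\tfrac12\sum_{x,y\in X}k(x,y)(\rho(y)-\rho(x))(\log\rho(y)-\log\rho(x))\pi(x)\in[0,\infty].$$ Curvature condition. With $\Upsilon(r)=e^r-1-r$, set $\Psi_\Upsilon(f)(x)=\sum_{y}k(x,y)\Upsilon(f(y)-f(x))$, $B_{\Upsilon'}(f,g)(x)=\sum_y k(x,y)\Upsilon'(f(y)-f(x))(g(y)-g(x))$, $\Psi_{2,\Upsilon}(f)=\frac12\big(L\Psi_\Upsilon(f)-B_{\Upsilon'}(f,Lf)\big)$. $L$ satisfies $CD_\Upsilon(\kappa,\infty)$ if $\Psi_{2,\Upsilon}(f)(x)\ge\kappa\Psi_\Upsilon(f)(x)$ for all $x\in X$ and all $f\in\ell^\infty(X)$. *)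

(* Defs.v *)
From HB Require Import structures.
From mathcomp Require Import all_boot all_order all_algebra.
From mathcomp Require Import all_classical all_reals all_analysis.

Set Implicit Arguments.
Unset Strict Implicit.
Unset Printing Implicit Defensive.

Import Order.TTheory GRing.Theory Num.Theory.
Import numFieldNormedType.Exports.

Local Open Scope classical_set_scope.
Local Open Scope ring_scope.

(* Sum of a family of arbitrary sign over a countable set, in the library's
   form for esum of differences; it is meaningful as soon as one of the two
   parts is finite. *)
Definition signed_esum (R : realType) (X : choiceType) (f : X -> \bar R) :
    \bar R :=
  (\esum_(x in [set: X]) (f^\+)%E x - \esum_(x in [set: X]) (f^\-)%E x)%E.

(* Real-valued version, used below only for absolutely convergent families. *)
Definition rsum (R : realType) (X : choiceType) (f : X -> R) : R :=
  fine (signed_esum (fun x => (f x)%:E)).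

Section rates.
Variables (R : realType) (X : countType) (k : X -> X -> R).

Definition M1 (x : X) : \bar R := \esum_(y in [set y | y != x]) (k x y)%:E.

Definition M2 (x : X) : \bar R :=
  \esum_(y in [set y | y != x]) ((k x y)%:E * M1 y)%E.

Definition transition_rates :=
  [/\ forall x y, x != y -> 0 <= k x y,
      forall x, (k x x)%:E = (- M1 x)%E &
      forall x, k x x < 0].

Definition irreducible_rates :=
  forall x y, exists s : seq X,
    [/\ s != [::], path (fun a b => 0 < k a b) x s & last x s = y].

Definition detailed_balance (pi : X -> R) :=
  forall x y, pi x * k x y = pi y * k y x.

Definition markov_generator (f : X -> R) (x : X) : R :=
  rsum (fun y => k x y * (f y - f x)).

Definition Upsilon (r : R) : R := expR r - 1 - r.

Definition Psi_Upsilon (f : X -> R) (x : X) : R :=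
  rsum (fun y => k x y * Upsilon (f y - f x)).

Definition B_dUpsilon (f g : X -> R) (x : X) : R :=
  rsum (fun y => k x y * (Upsilon^`())%classic (f y - f x) * (g y - g x)).

Definition Psi2_Upsilon (f : X -> R) (x : X) : R :=
  2^-1 * (markov_generator (Psi_Upsilon f) x - B_dUpsilon f (markov_generator f) x).

Definition CD_Upsilon (kappa : R) :=
  forall f : X -> R, bounded_fun f ->
    forall x, kappa * Psi_Upsilon f x <= Psi2_Upsilon f x.

End rates.

(* Functions on X, and their integrability with respect to the measure mu with
   density pi with respect to counting measure. *)
Section functions.
Variables (R : realType) (X : countType) (pi : X -> R).

Definition probability_density :=
  (forall x, 0 < pi x) /\ \esum_(x in [set: X]) (pi x)%:E = 1%E.

Definition in_lp (p : nat) (g : X -> \bar R) :=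
  (\esum_(x in [set: X]) (`|g x| ^+ p * (pi x)%:E) < +oo)%E.

Definition P_star (f : X -> R) :=
  (forall x, 0 < f x) /\ \esum_(x in [set: X]) (f x * pi x)%:E = 1%E.

Definition P_star_plus (f : X -> R) :=
  [/\ P_star f, bounded_fun f & 0 < inf (range f)].

(* For f in P_star the negative part of the family is summable, because
   r * ln r >= - expR (-1) and mu is finite. *)
Definition entropy (f : X -> R) : \bar R :=
  signed_esum (fun x => (f x * ln (f x) * pi x)%:E).

Definition Fisher_information (k : X -> X -> R) (f : X -> R) : \bar R :=
  ((2^-1)%:E * \esum_(p in [set: X * X])
     (k p.1 p.2 * (f p.2 - f p.1) * (ln (f p.2) - ln (f p.1)) * pi p.1)%:E)%E.

End functions.

(* The continuous-time Markov chain with rates k, through its jump chain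
   Y 0, Y 1, ... and holding times S 0, S 1, ...; Pr x is the law of the chain
   started at x. *)
Section chain.
Variables (R : realType) (X : countType) (k : X -> X -> R).
Variables (d : measure_display) (Omega : measurableType d).
Variables (Pr : X -> probability Omega R).
Variables (Y : nat -> Omega -> X) (S : nat -> Omega -> R).

Definition jump_matrix (x y : X) : R :=
  if x == y then 0 else k x y / (- k x x).

(* Under Pr x, the jump chain starts at x and has transition matrix
   jump_matrix; conditionally on it, the holding times are independent, the one
   in state z being exponential with rate - k z z. *)
Definition is_markov_chain :=
  [/\ forall n x, measurable [set w | Y n w = x],
      forall n, measurable_fun [set: Omega] (S n),
      forall n w, 0 < S n w &
      forall (x : X) (n : nat) (z : nat -> X) (A : nat -> set R),
        (forall i, measurable (A i)) ->
        Pr x [set w | forall i, (i <= n)%N -> Y i w = z i /\ A i (S i w)] =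
        ((z 0 == x)%:R * (\prod_(i < n) jump_matrix (z i) (z i.+1)) *
         \prod_(i < n.+1)
           fine (exponential_prob (- k (z i) (z i)) (A i)))%:E].

Definition jump_time (n : nat) (w : Omega) : R := \sum_(i < n) S i w.

(* The state at time t, and None from the explosion time on. *)
Definition state (t : R) (w : Omega) : option X :=
  xget None [set Some (Y n w) |
    n in [set n | jump_time n w <= t < jump_time n.+1 w]].

(* E (f (Z_t) | Z_0 = x), where f (Z_t) is 0 after explosion. *)
Definition semigroup (t : R) (f : X -> R) (x : X) : R :=
  fine ('E_(Pr x)[fun w => oapp f 0%R (state t w)])%E.

Definition non_explosive :=
  forall t, 0 <= t -> semigroup t (cst 1) = cst 1.

Definition invariant_density (pi : X -> R) :=
  forall t, 0 <= t -> forall y,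
    \esum_(x in [set: X]) ((pi x)%:E * Pr x [set w | state t w = Some y])%E =
    (pi y)%:E.

End chain.

(* Main.v *)
Require Import Defs.
From HB Require Import structures.
From mathcomp Require Import all_boot all_order all_algebra finmap.
From mathcomp Require Import all_classical all_reals all_analysis.
From mathcomp Require Import measurable_realfun ring lra.

Import Order.TTheory GRing.Theory Num.Theory.
Import numFieldNormedType.Exports.

Local Open Scope classical_set_scope.
Local Open Scope ring_scope.

Set Implicit Arguments.
Unset Strict Implicit.
Unset Printing Implicit Defensive.

(* For f bounded and bounded away from 0, expanding P_t f over the paths of the
   jump chain gives the integrated first-jump equation
     u_t x = e^(-q t) (f x + int_0^t e^(q r) sum_(y != x) k(x,y) u_r y dr),  q = - k(x,x),
   whose right-hand side is C^1; so u_t = P_t f is a bounded positive solution of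
   the backward equation u' = L u.  Integrals against pi become sums over edges for
   the symmetric flow pi(x) k(x,y); all integrands are bounded by multiples of
   1 + M1(x) + M1(y), whose total flow is finite because M1 is in l^2(mu).  This
   justifies differentiating under the sum, and summation by parts gives
     H(u)' = - I(u),   I(u)' = - 2 sum_x pi u Psi_2(ln u) <= - 2 kappa I(u).
   Hence I(u_t) -> 0; irreducibility and conservation of mass force u_t -> 1 and
   H(u_t) -> 0.  As H - I / (2 kappa) is nondecreasing along the flow and H tends
   to 0, it is nonpositive at time 0, which is MLSI for f; then
   H' = - I <= - 2 kappa H gives the exponential decay.  For general f, truncate
   to [1/N, N] and renormalize: truncation decreases every term of I. *)

(** * Absolutely convergent sums *)

(** No Markov property of the chain is at hand: the hypothesis prescribes only the probability of a
    path of the jump chain together with a box of holding times. The first-jump equation is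
    therefore derived path by path. Given the path, jump times are sums of independent exponentials,
    their distribution functions are iterated primitives, and the recursion between these
    primitives, summed over all paths, is the equation. The rates may be unbounded, so [L u] need
    not be bounded when u is. The working class is |a| <= C (1 + M1): it contains [L] of every
    bounded function, its gradients are summable against the flow, and finiteness of M2 lets [L] act
    on it once more, as Psi_2 requires. Non-explosion preserves the lower bound inf f <= u_t. Hence
    ln u_t is bounded, which is what permits CD to be applied to it. Vanishing Fisher information
    controls gradients through (s - r)^2 <= b (s - r)(ln s - ln r) for s, r in ]0, b]. Derivatives
    are two-sided, so u is frozen at its initial value for negative times; identities hold for t > 0
    and reach t = 0 by continuity. *)

Section absolutely_convergent_sums.
Context {R : realType} {T : choiceType}.
Implicit Types f g : T -> R.

Definition summableR f := summable [set: T] (fun x => (f x)%:E).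

Lemma summableRE f : summableR f = (\esum_(x in [set: T]) `|f x|%:E < +oo)%E.
Proof. by []. Qed.

Lemma le_summableR f g : (forall x, `|f x| <= g x) -> summableR g -> summableR f.
Proof.
move=> fg; apply: le_lt_trans; apply: le_esum => x _.
by rewrite lee_fin (le_trans (fg x))// ler_norm.
Qed.

Lemma summableRD f g : summableR f -> summableR g -> summableR (fun x => f x + g x).
Proof. exact: summableD. Qed.

Lemma summableR_norm f : summableR f -> summableR (fun x => `|f x|).
Proof. by rewrite !summableRE;
  under [in X in _ -> X]eq_esum do rewrite normr_id. Qed.

Lemma summableRN f : summableR f -> summableR (fun x => - f x).
Proof. by move=> /summableR_norm; apply: le_summableR => x; rewrite normrN. Qed.

Lemma summableRB f g : summableR f -> summableR g -> summableR (fun x => f x - g x).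
Proof. by move=> ff /summableRN; exact: summableRD. Qed.

Lemma esumZl (c : R) (a : T -> \bar R) : 0 <= c -> (forall x, 0 <= a x)%E ->
  (\esum_(x in [set: T]) (c%:E * a x) = c%:E * \esum_(x in [set: T]) a x)%E.
Proof.
move=> c0 a0.
have H (c' : R) (b : T -> \bar R) : 0 <= c' -> (forall x, 0 <= b x)%E ->
  (\esum_(x in [set: T]) (c'%:E * b x) <= c'%:E * \esum_(x in [set: T]) b x)%E.
  move=> c'0 b0; apply: ge_ereal_sup => _ [A [finA _] <-].
  rewrite fsbig_finite// -ge0_sume_distrr//.
  apply: lee_wpmul2l; rewrite ?lee_fin//.
  apply: ereal_sup_ubound; exists A => //.
  by rewrite fsbig_finite.
apply/eqP; rewrite eq_le H//=.
have [->|cn0] := eqVneq c 0; first by rewrite mul0e esum_ge0// => x _;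
  rewrite mul0e.
have cp : 0 < c by rewrite lt_neqAle eq_sym cn0.
rewrite -lee_pdivlMl//.
(* The reverse inequality is the first one, applied to c^-1 and the family c * a. *)
have := @H c^-1 (fun x => c%:E * a x)%E.
under [in X in (X <= _)%E]eq_esum do rewrite muleA -EFinM mulVf// mul1e.
by apply => [|x]; rewrite ?invr_ge0// mule_ge0.
Qed.

Lemma summableRZ (c : R) f : summableR f -> summableR (fun x => c * f x).
Proof.
move=> ff; rewrite !summableRE; under eq_esum do rewrite normrM EFinM.
by rewrite esumZl// lte_mul_pinfty.
Qed.

Lemma rsum_ge0E f : (forall x, 0 <= f x) ->
  signed_esum (fun x => (f x)%:E) = \esum_(x in [set: T]) (f x)%:E.
Proof.
move=> f0; rewrite /signed_esum [X in (_ - X)%E]esum1 ?sube0.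
  by apply: eq_esum => x _; rewrite funeposE max_l// lee_fin.
by move=> x _; rewrite funenegE max_r// leeNl oppe0 lee_fin.
Qed.

Lemma rsum_ge0 f : (forall x, 0 <= f x) -> 0 <= rsum f.
Proof.
by move=> f0; rewrite /rsum rsum_ge0E// fine_ge0// esum_ge0// => x _;
  rewrite lee_fin.
Qed.

Lemma signed_esumE f : summableR f -> signed_esum (fun x => (f x)%:E) = (rsum f)%:E.
Proof.
move=> ff; rewrite /rsum fineK// /signed_esum fin_numB; apply/andP; split.
  have := summable_funepos ff; rewrite summableE => h; move: h.
  by under eq_esum do rewrite gee0_abs//.
have := summable_funeneg ff; rewrite summableE => h; move: h.
by under eq_esum do rewrite gee0_abs//.
Qed.

Lemma rsum_esum f : summableR f -> (forall x, 0 <= f x) ->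
  (rsum f)%:E = \esum_(x in [set: T]) (f x)%:E.
Proof. by move=> ff f0; rewrite -signed_esumE// rsum_ge0E. Qed.

Let rsumB_ge0 f g : summableR f -> summableR g -> (forall x, 0 <= f x) ->
  (forall x, 0 <= g x) -> rsum (fun x => f x - g x) = rsum f - rsum g.
Proof.
move=> ff gg f0 g0; apply: EFin_inj; rewrite EFinB -signed_esumE;
  last exact: summableRB.
by rewrite rsum_esum// rsum_esum// -(esumB ff gg)//= => i _; rewrite lee_fin.
Qed.

Let rsumD_ge0 f g : summableR f -> summableR g -> (forall x, 0 <= f x) ->
  (forall x, 0 <= g x) -> rsum (fun x => f x + g x) = rsum f + rsum g.
Proof.
move=> ff gg f0 g0; apply: EFin_inj; rewrite EFinD !rsum_esum//.
- by rewrite -esumD// => i _; rewrite lee_fin.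
- exact: summableRD.
- by move=> x; rewrite addr_ge0.
Qed.

(** Positive and negative parts, written through the norm so that linear arithmetic proves their
    properties. Additivity, known so far for nonnegative families, is carried to all signs by
    [rsum_pn]. *)
Let pp f x := (`|f x| + f x) / 2.
Let np f x := (`|f x| - f x) / 2.
Let pp_ge0 f x : 0 <= pp f x.
Proof. by rewrite /pp; have := ler_norm (- f x); rewrite normrN; lra. Qed.
Let np_ge0 f x : 0 <= np f x.
Proof. by rewrite /np; have := ler_norm (f x); lra. Qed.
Let summableR_pp f : summableR f -> summableR (pp f).
Proof.
move=> /summableR_norm; apply: le_summableR => x; rewrite ger0_norm//.
by rewrite /pp; have := ler_norm (f x); lra.
Qed.
Let summableR_np f : summableR f -> summableR (np f).
Proof.
move=> /summableR_norm; apply: le_summableR => x; rewrite ger0_norm//.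
by rewrite /np; have := ler_norm (- f x); rewrite normrN; lra.
Qed.
Let rsum_pn f : summableR f -> rsum f = rsum (pp f) - rsum (np f).
Proof.
move=> ff; rewrite -rsumB_ge0//; [|exact: summableR_pp|exact: summableR_np].
by congr rsum; apply/funext => x; rewrite /pp /np; field.
Qed.

Lemma rsumD f g : summableR f -> summableR g ->
  rsum (fun x => f x + g x) = rsum f + rsum g.
Proof.
move=> ff gg; rewrite (rsum_pn ff) (rsum_pn gg).
rewrite addrACA -opprD -!rsumD_ge0//;
  [|exact: summableR_np..|exact: summableR_pp|exact: summableR_pp].
rewrite -rsumB_ge0//; first last.
- by move=> x; rewrite addr_ge0.
- by move=> x; rewrite addr_ge0.
- by apply: summableRD; exact: summableR_np.
- by apply: summableRD; exact: summableR_pp.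
by congr rsum; apply/funext => x; rewrite /pp /np; field.
Qed.

Lemma rsumN f : summableR f -> rsum (fun x => - f x) = - rsum f.
Proof.
move=> ff; apply/eqP; rewrite -addr_eq0 -rsumD//; last exact: summableRN.
have -> : (fun x => - f x + f x) = (fun x => `|f x| - `|f x|).
  by apply/funext => x; rewrite addNr subrr.
by rewrite rsumB_ge0 ?subrr//; exact: summableR_norm.
Qed.

Lemma rsumB f g : summableR f -> summableR g ->
  rsum (fun x => f x - g x) = rsum f - rsum g.
Proof. by move=> ff gg; rewrite rsumD ?rsumN//; exact: summableRN. Qed.

Lemma rsumZ (c : R) f : summableR f -> rsum (fun x => c * f x) = c * rsum f.
Proof.
wlog c0 : c / 0 <= c.
  move=> h; have [|cl ff] := leP 0 c; first exact: h.
  rewrite -[in RHS](opprK c) mulNr -h ?oppr_ge0 ?ltW// -rsumN;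
    last exact: summableRZ.
  by congr rsum; apply/funext => x; rewrite mulNr opprK.
have h g : summableR g -> (forall x, 0 <= g x) ->
  rsum (fun x => c * g x) = c * rsum g.
  move=> gg g0; apply: EFin_inj; rewrite EFinM !rsum_esum//.
  - by under eq_esum do rewrite EFinM; rewrite esumZl// => x; rewrite lee_fin.
  - exact: summableRZ.
  - by move=> x; rewrite mulr_ge0.
move=> ff; rewrite (rsum_pn ff) mulrBr -!h//;
  [|exact: summableR_np|exact: summableR_pp].
rewrite -rsumB_ge0//; first last.
- by move=> x; rewrite mulr_ge0.
- by move=> x; rewrite mulr_ge0.
- by apply: summableRZ; exact: summableR_np.
- by apply: summableRZ; exact: summableR_pp.
by congr rsum; apply/funext => x; rewrite /pp /np; field.
Qed.

Lemma le_rsum f g : summableR f -> summableR g -> (forall x, f x <= g x) ->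
  rsum f <= rsum g.
Proof.
move=> ff gg fg; rewrite -subr_ge0 -rsumB//.
by apply: rsum_ge0 => x; rewrite subr_ge0.
Qed.

Lemma normr_rsum f : summableR f -> `|rsum f| <= rsum (fun x => `|f x|).
Proof.
move=> ff; have nf := summableR_norm ff.
rewrite ler_norml -rsumN//; apply/andP; split.
  by apply: le_rsum => //; [exact: summableRN|move=> x;
    rewrite lerNl -normrN ler_norm].
by apply: le_rsum => // x; exact: ler_norm.
Qed.

Lemma summableR_fset (F : {fset T}) f : (forall x, x \notin F -> f x = 0) ->
  summableR f.
Proof.
move=> f0; rewrite summableRE (_ : (\esum_(x in _) _ =
  \esum_(x in [set` F]) `|f x|%:E)%E).
  rewrite esum_fset//; rewrite fsbig_finite//= sumEFin ltry//.
rewrite [RHS]esum_mkcond; apply: eq_esum => x _; case: ifPn => //.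
by rewrite notin_setE/= => /negP/f0 ->; rewrite normr0.
Qed.

Lemma rsum_fset (F : {fset T}) f : (forall x, x \notin F -> f x = 0) ->
  rsum f = \sum_(x <- F) f x.
Proof.
move=> f0.
have h g : (forall x, x \notin F -> g x = 0) -> (forall x, 0 <= g x) ->
    rsum g = \sum_(x <- F) g x.
  move=> g0 gp; apply: EFin_inj; rewrite rsum_esum//;
    last exact: (@summableR_fset F).
  transitivity (\esum_(x in [set` F]) (g x)%:E)%E.
    rewrite [RHS]esum_mkcond; apply: eq_esum => x _; case: ifPn => //.
    by rewrite notin_setE/= => /negP/g0 ->.
  rewrite esum_fset//; last by move=> *; rewrite lee_fin.
  by rewrite fsbig_finite//= sumEFin set_fsetK.
rewrite rsum_pn; last exact: (@summableR_fset F).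
rewrite !h// -?sumrB; first last.
- by move=> x /f0; rewrite /pp => ->; rewrite normr0 addr0 mul0r.
- by move=> x /f0; rewrite /np => ->; rewrite normr0 subr0 mul0r.
by apply: eq_bigr => x _; rewrite /pp /np; field.
Qed.

(** The finite set depends on the dominating g only and serves every f below it; this uniformity is
    what dominated convergence needs. *)
Lemma rsum_tail g (e : R) : summableR g -> (forall x, 0 <= g x) -> 0 < e ->
  exists F : {fset T}, forall f, (forall x, `|f x| <= g x) ->
    `|rsum f - \sum_(x <- F) f x| <= e.
Proof.
move=> gg g0 e0.
have : (((rsum g - e)%:E < \esum_(x in [set: T]) (g x)%:E)%E).
  by rewrite -rsum_esum// lte_fin; lra.
move=> /ereal_sup_gt[_ [A [finA _] <-]].
rewrite fsbig_finite//= sumEFin lte_fin => hA; exists (fset_set A) => f fg.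
set F := fset_set A in hA *.
have ff : summableR f by exact: le_summableR fg gg.
pose r h x : R := if x \in F then h x else 0.
have rE h : rsum (r h) = \sum_(x <- F) h x.
  rewrite (@rsum_fset F) => [|x xF]; last by rewrite /r (negPf xF).
  by rewrite big_seq [RHS]big_seq; apply: eq_bigr => x xF; rewrite /r xF.
have smr h : summableR (r h) by apply: (@summableR_fset F) => x xF;
  rewrite /r (negPf xF).
rewrite -rE -rsumB//.
apply: (le_trans (normr_rsum _)); first exact: summableRB.
apply: (@le_trans _ _ (rsum (fun x => g x - r g x))).
  apply: le_rsum; [exact/summableR_norm/summableRB|exact: summableRB|].
  by move=> x; rewrite /r; case: ifPn => _; rewrite ?subrr ?normr0// !subr0.
by rewrite rsumB// rE; lra.
Qed.

(** Dominated convergence along an arbitrary filter, since it serves for t near a point, difference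
    quotients, t to infinity and sequences. The error is two tails and one finite sum, e / 3
    each. *)
Lemma rsum_cvg {U : Type} (F : set_system U) {FF : Filter F} (f : U -> T -> R)
    (l g : T -> R) : summableR g ->
  (\forall u \near F, forall x, `|f u x| <= g x) ->
  (forall x, `|l x| <= g x) ->
  (forall x, f ^~ x @ F --> l x) ->
  (fun u => rsum (f u)) @ F --> rsum l.
Proof.
move=> gg fg lg fl; apply/cvgrPdist_le => e e0.
have g0 x : 0 <= g x by exact: le_trans (lg x).
have e3 : 0 < e / 3 by lra.
have [A hA] := rsum_tail gg g0 e3.
have cF : (fun u => \sum_(x <- A) f u x) @ F --> \sum_(x <- A) l x.
  elim: (enum_fset A) => [|x r ih].
    by under eq_fun do rewrite big_nil; rewrite big_nil; exact: cvg_cst.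
  by under eq_fun do rewrite big_cons; rewrite big_cons; apply: cvgD.
move/cvgrPdist_le : cF => /(_ _ e3) cF.
near=> u.
have h1 := hA l lg.
have h2 : `|rsum (f u) - \sum_(x <- A) f u x| <= e / 3 by apply: hA; near: u.
have h3 : `|\sum_(x <- A) l x - \sum_(x <- A) f u x| <= e / 3 by near: u.
move: h1 h2 h3; rewrite !ler_norml => /andP[? ?] /andP[? ?] /andP[? ?].
by apply/andP; split; lra.
Unshelve. all: by end_near. Qed.

Lemma rsum_ge_term f (t : T) :
  summableR f -> (forall x, 0 <= f x) -> f t <= rsum f.
Proof.
move=> sf f0; pose g x := if x == t then f t else 0.
have g0 x : x \notin [fset t]%fset -> g x = 0.
  by rewrite in_fset1 /g => /negPf ->.
have -> : f t = rsum g by rewrite (rsum_fset g0) big_seq_fset1 /g eqxx.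
apply: le_rsum => //; first exact: summableR_fset g0.
by move=> x; rewrite /g; case: eqP => [->//|].
Qed.

Lemma summableR_decomp f : summableR f -> exists p n : T -> R,
  [/\ summableR p, summableR n, (forall x, 0 <= p x), (forall x, 0 <= n x) &
     f = (fun x => p x - n x)].
Proof.
move=> ff; exists (pp f), (np f); split => //;
  [exact: summableR_pp|exact: summableR_np|].
by apply/funext => x; rewrite /pp /np; field.
Qed.

End absolutely_convergent_sums.

(** * Double sums: Tonelli and Fubini *)

Section pair_sums.
Context {R : realType} {T1 T2 : choiceType}.
Implicit Types F : T1 * T2 -> R.

Lemma esum_pair (a : T1 * T2 -> \bar R) : (forall p, 0 <= a p)%E ->
  (\esum_(p in [set: T1 * T2]) a p =
   \esum_(x in [set: T1]) \esum_(y in [set: T2]) a (x, y))%E.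
Proof.
move=> a0; rewrite (@esum_esum _ _ _ setT (fun=> setT) (fun x y => a (x, y)))//.
rewrite (_ : setT `*`` (fun=> setT) = setT); first by apply: eq_esum => -[].
by apply/seteqP; split.
Qed.

Lemma summableR_slice F x : summableR F -> summableR (fun y => F (x, y)).
Proof.
rewrite !summableRE; apply: le_lt_trans; rewrite esum_pair//.
pose h z := (\esum_(y in [set: T2]) `|F (z, y)|%:E)%E.
have h0 z : (0 <= h z)%E by exact: esum_ge0.
rewrite -[leLHS]/(h x) -(esum_set1 (h0 x)) esum_mkcond.
by apply: le_esum => z _; case: ifP => // _; exact: h0.
Qed.

Lemma summableR_rsum_slice F : summableR F ->
  summableR (fun x => rsum (fun y => F (x, y))).
Proof.
move=> FF; move: (FF); rewrite !summableRE; apply: le_lt_trans; rewrite esum_pair//.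
apply: le_esum => x _; have /= Fx := summableR_slice x FF.
rewrite -rsum_esum//; [|exact: summableR_norm]; rewrite lee_fin; exact: normr_rsum.
Qed.

Lemma rsum_pair F : summableR F ->
  rsum F = rsum (fun x => rsum (fun y => F (x, y))).
Proof.
move=> /summableR_decomp[p [n [sp sn p0 n0 ->]]].
have h (G : T1 * T2 -> R) : summableR G -> (forall z, 0 <= G z) ->
    rsum G = rsum (fun x => rsum (fun y => G (x, y))).
  move=> sG G0; have so := summableR_rsum_slice sG.
  have s0 x : 0 <= rsum (fun y => G (x, y)) by exact: rsum_ge0.
  apply: EFin_inj; rewrite (rsum_esum sG G0) (rsum_esum so s0) esum_pair//.
  by apply: eq_esum => x _; rewrite rsum_esum//; exact: summableR_slice.
rewrite rsumB// !h// -rsumB; [|exact: summableR_rsum_slice..].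
by congr rsum; apply/funext => x; rewrite rsumB//; exact: summableR_slice.
Qed.

Lemma summableR_pair F : (forall z, 0 <= F z) ->
  (forall x, summableR (fun y => F (x, y))) ->
  summableR (fun x => rsum (fun y => F (x, y))) -> summableR F.
Proof.
move=> F0 Fx; rewrite !summableRE esum_pair//; apply: le_lt_trans.
apply: le_esum => x _; rewrite -rsum_esum//; last exact: summableR_norm.
rewrite lee_fin (_ : (fun y => `|F (x, y)|) = (fun y => F (x, y))) ?ler_norm//.
by apply/funext => y; rewrite ger0_norm.
Qed.

Let swap_bij : set_bij [set: T2 * T1] [set: T1 * T2] (fun p => (p.2, p.1)).
Proof.
split => //; first by move=> [x y] [x' y'] _ _ [-> ->].
by move=> [x y] _; exists (y, x).
Qed.

Lemma summableR_swap F : summableR F -> summableR (fun p : T2 * T1 => F (p.2, p.1)).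
Proof.
by rewrite !summableRE (reindex_esum _ _ _ _ swap_bij).
Qed.

Lemma rsum_swap F : rsum (fun p : T2 * T1 => F (p.2, p.1)) = rsum F.
Proof.
rewrite /rsum /signed_esum; congr (fine (_ - _)%E).
  rewrite (reindex_esum _ _ _ _ swap_bij).
  by apply: eq_esum => z _; rewrite !funeposE.
rewrite (reindex_esum _ _ _ _ swap_bij).
by apply: eq_esum => z _; rewrite !funenegE.
Qed.

End pair_sums.

Section esum_exchange.
Context {R : realType} {T1 T2 : choiceType}.

Lemma esum_exchange (a : T1 -> T2 -> \bar R) : (forall x y, 0 <= a x y)%E ->
  (\esum_(x in [set: T1]) \esum_(y in [set: T2]) a x y =
   \esum_(y in [set: T2]) \esum_(x in [set: T1]) a x y)%E.
Proof.
move=> a0; rewrite -(@esum_pair _ _ _ (fun p => a p.1 p.2))//.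
rewrite -(@esum_pair _ _ _ (fun p => a p.2 p.1))//.
rewrite (reindex_esum [set: T2 * T1] _ (fun p => (p.2, p.1)))//.
split => //; first by move=> [x y] [x' y'] _ _ [-> ->].
by move=> [x y] _; exists (y, x).
Qed.

End esum_exchange.

(** * Differentiation under the sum *)

Section derivative_of_sums.
Context {R : realType} {T : choiceType}.

Lemma is_derive_lipschitz (f f' : R -> R) (t r C : R) : 0 < r ->
  (forall s, `|s - t| < r -> is_derive s 1 f (f' s)) ->
  (forall s, `|s - t| < r -> `|f' s| <= C) ->
  forall s, `|s - t| < r -> `|f s - f t| <= C * `|s - t|.
Proof.
move=> r0 df f'C s st.
have inr c : (t <= c <= s) || (s <= c <= t) -> `|c - t| < r.
  move: st; rewrite !ltr_norml => /andP[? ?] /orP[]/andP[? ?];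
    apply/andP; split; lra.
have cf c : (t <= c <= s) || (s <= c <= t) -> {for c, continuous f}.
  move=> /inr/df dfc; apply: differentiable_continuous.
  exact/derivable1_diffP.
have [ts|st'] := leP t s.
  have [c||c ci ->] := @MVT_segment R f f' t s ts.
  - by rewrite in_itv/= => /andP[? ?]; apply/df/inr/orP; left; rewrite !ltW.
  - apply: continuous_in_subspaceT => c; rewrite inE/= in_itv/= => /andP[h1 h2].
    by apply: cf; rewrite h1 h2.
  rewrite normrM ler_wpM2r//; apply/f'C/inr.
  by move: ci; rewrite in_itv/= => ->.
have [c||c ci] := @MVT_segment R f f' s t (ltW st').
- by rewrite in_itv/= => /andP[? ?]; apply/df/inr/orP; right; rewrite !ltW.
- apply: continuous_in_subspaceT => c; rewrite inE/= in_itv/= => /andP[h1 h2].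
  by apply: cf; rewrite h1 h2 orbT.
rewrite distrC => ->; rewrite normrM (distrC t) ler_wpM2r//; apply/f'C/inr.
by move: ci; rewrite in_itv/= => ->; rewrite orbT.
Qed.

(** By the mean value theorem a bound g on the derivatives near t also bounds the difference
    quotients, so dominated convergence applies to them. *)
Lemma is_derive_rsum (f f' : R -> T -> R) (g : T -> R) (t r : R) : 0 < r ->
  summableR g -> (forall s, `|s - t| < r -> summableR (f s)) ->
  (forall s x, `|s - t| < r -> is_derive s 1 (f ^~ x) (f' s x)) ->
  (forall s x, `|s - t| < r -> `|f' s x| <= g x) ->
  is_derive t 1 (fun s => rsum (f s)) (rsum (f' t)).
Proof.
move=> r0 gg ff df f'g.
have tt : `|t - t| < r by rewrite subrr normr0.
have nr : \forall h \near (0 : R)^', `|h + t - t| < r.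
  by near=> h; rewrite addrK; near: h; apply: dnbhs0_lt.
have cv : (fun h => h^-1 *: (rsum (f (h *: 1 + t)) - rsum (f t))) @ 0^'
    --> rsum (f' t).
  apply: (@cvg_trans _ ((fun h => rsum (fun x => h^-1 * (f (h + t) x - f t x)))
    @ (0 : R)^')).
    apply: near_eq_cvg; near=> h.
    have hr : `|h + t - t| < r by near: h.
    rewrite rsumZ; last by apply: summableRB; exact: ff.
    rewrite rsumB; [|exact: ff..].
    by rewrite /GRing.scale/= mulr1.
  apply: (rsum_cvg gg).
  - near=> h => x.
    have hr : `|h + t - t| < r by near: h.
    have h0 : h != 0 by near: h; exact: nbhs_dnbhs_neq.
    have := @is_derive_lipschitz _ _ _ _ (g x) r0
      (fun s => @df s x) (fun s => @f'g s x) (h + t) hr.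
    rewrite addrK normrM normfV => /ler_wpM2l - /(_ `|h|^-1).
    rewrite invr_ge0 normr_ge0 => /(_ isT) /le_trans; apply.
    by rewrite mulrCA mulVf ?mulr1// normr_eq0.
  - by move=> x; exact: f'g.
  - move=> x; have dx := df t x tt.
    have := @ex_derive _ _ _ _ _ _ _ dx; rewrite /derivable => /cvg_ex[l hl].
    have := @derive_val _ _ _ _ _ _ _ dx; rewrite /derive (cvg_lim _ hl)// => <-.
    by apply: cvg_trans hl; apply: near_eq_cvg; near=> h;
      rewrite /=/GRing.scale/= mulr1.
apply: DeriveDef; first by apply/cvg_ex; exists (rsum (f' t)).
by apply/cvg_lim.
Unshelve. all: by end_near. Qed.

End derivative_of_sums.

(** * Reversible rates and sums over edges *)
Section real_functions.
Context {R : realType}.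
Implicit Types f : R -> R.

Lemma ln_le_subr1 (x : R) : 0 < x -> ln x <= x - 1.
Proof.
move=> x0; rewrite lerBrDr -[leRHS](@lnK _ x) ?posrE// addrC.
exact: expR_ge1Dx.
Qed.

(** For r <= s, ln (r / s) <= r / s - 1 gives ln s - ln r >= (s - r) / s >= (s - r) / b. This is how
    a small Fisher information forces small gradients. *)
Lemma sqr_diff_le (b s r : R) : 0 < s -> s <= b -> 0 < r -> r <= b ->
  (s - r) ^+ 2 <= b * ((s - r) * (ln s - ln r)).
Proof.
wlog rs : s r / r <= s.
  move=> h s0 sb r0 rb; have [rs|/ltW sr] := leP r s; first exact: h.
  by have := h r s sr r0 rb s0 sb; lra.
move=> s0 sb r0 rb.
have := ln_le_subr1 (divr_gt0 r0 s0); rewrite ln_div ?posrE// => h.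
have h1 : (s - r) / s <= ln s - ln r.
  by rewrite mulrBl divff ?gt_eqF//; lra.
have b0 : 0 < b by exact: lt_le_trans sb.
rewrite expr2 mulrCA; apply: ler_wpM2l; first by rewrite subr_ge0.
apply: (@le_trans _ _ (b * ((s - r) / s))); last first.
  by apply: ler_wpM2l h1; exact: ltW.
rewrite mulrCA ler_peMr ?subr_ge0// ler_pdivlMr// mul1r//.
Qed.

Lemma derive1_Upsilon (r : R) : (@Upsilon R)^`()%classic r = expR r - 1.
Proof.
rewrite derive1E.
have h : is_derive r 1 (@Upsilon R) (expR r - 0 - 1).
  rewrite /Upsilon; apply: is_deriveB.
rewrite derive_val; ring.
Qed.

Lemma le0_derive_homo f (f' : R -> R) : continuous f ->
  (forall s : R, 0 < s -> is_derive s 1 f (f' s)) ->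
  (forall s : R, 0 < s -> f' s <= 0) -> forall s t : R, 0 <= s -> s <= t ->
    f t <= f s.
Proof.
move=> cf df f'0 s t s0 st.
(* The intermediate point lies in the closed segment and may be 0, where nothing is known about f';
   the value 0 there keeps the sign. *)
have [c||c _ e] := @MVT_segment R f (fun c => if 0 < c then f' c else 0) s t st.
- rewrite in_itv/= => /andP[sc _]; have c0 : 0 < c by exact: le_lt_trans sc.
  by rewrite c0; exact: df.
- exact: continuous_subspaceT.
rewrite -subr_le0 e mulr_le0_ge0 ?subr_ge0//.
by case: ifPn => // /f'0.
Qed.

End real_functions.

Section reversible_rates.
Context {R : realType} {X : countType}.
Variables (k : X -> X -> R) (pi : X -> R).
Hypothesis k_rates : transition_rates k.
Hypothesis pi_prob : probability_density pi.
Hypothesis pi_db : detailed_balance k pi.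
Hypothesis M1_fin : forall x, (M1 k x < +oo)%E.
Hypothesis M2_fin : forall x, (M2 k x < +oo)%E.
Hypothesis M1_l2 : in_lp pi 2 (M1 k).

(** The diagonal rate is negative. Removing it leaves nonnegative weights and costs nothing, because
    the summands of the generator, of Psi and of B all vanish at y = x. *)
Definition off_diag x y := if y == x then 0 else k x y.
Definition exit_rate x := - k x x.
Definition flow (p : X * X) := pi p.1 * off_diag p.1 p.2.

Local Notation kk := off_diag.
Local Notation m1 := exit_rate.
Local Notation w := flow.

Lemma off_diag_ge0 x y : 0 <= kk x y.
Proof.
by rewrite /kk; case: eqP => // /eqP h; case: k_rates => + _ _; apply;
  rewrite eq_sym.
Qed.

Lemma exit_rate_gt0 x : 0 < m1 x.
Proof. by case: k_rates => _ _ /(_ x); rewrite oppr_gt0. Qed.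

Lemma exit_rate_ge0 x : 0 <= m1 x. Proof. exact/ltW/exit_rate_gt0. Qed.

Lemma esum_off_diag x (a : X -> \bar R) :
  (\esum_(y in [set y | y != x]) ((k x y)%:E * a y) =
   \esum_(y in [set: X]) ((kk x y)%:E * a y))%E.
Proof.
rewrite esum_mkcond; apply: eq_esum => y _; rewrite /kk.
case: ifPn => [|]; first by rewrite inE/= => /negPf ->.
by rewrite notin_setE/= => /negP/negPn ->; rewrite mul0e.
Qed.

Lemma M1E x : M1 k x = (m1 x)%:E.
Proof. by case: k_rates => _ h _; rewrite EFinN h oppeK. Qed.

Lemma M1_off_diag x : M1 k x = (\esum_(y in [set: X]) (kk x y)%:E)%E.
Proof.
have := @esum_off_diag x (cst 1%E).
under eq_esum do rewrite mule1; rewrite /M1 => ->.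
by apply: eq_esum => y _; rewrite mule1.
Qed.

Lemma summableR_off_diag x : summableR (kk x).
Proof.
rewrite summableRE; have := M1_fin x; rewrite M1_off_diag; apply: le_lt_trans.
by apply: le_esum => y _; rewrite ger0_norm// off_diag_ge0.
Qed.

Lemma rsum_off_diag x : rsum (kk x) = m1 x.
Proof.
apply: EFin_inj; rewrite -M1E rsum_esum;
  [|exact: summableR_off_diag|exact: off_diag_ge0].
by rewrite M1_off_diag.
Qed.

Lemma summableR_off_diag_rate x : summableR (fun y => kk x y * m1 y).
Proof.
rewrite summableRE; have := M2_fin x; rewrite /M2 esum_off_diag; apply: le_lt_trans.
apply: le_esum => y _.
by rewrite M1E ger0_norm// mulr_ge0// ?off_diag_ge0// exit_rate_ge0.
Qed.

Lemma pi_gt0 x : 0 < pi x. Proof. by case: pi_prob. Qed.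

Lemma summableR_pi : summableR pi.
Proof.
rewrite summableRE; under eq_esum do rewrite ger0_norm ?(ltW (pi_gt0 _))//.
by case: pi_prob => _ ->; rewrite ltry.
Qed.

Lemma rsum_pi : rsum pi = 1.
Proof.
apply: EFin_inj; rewrite rsum_esum; [|exact: summableR_pi|by move=> x;
  rewrite ltW// pi_gt0].
by case: pi_prob => _ ->.
Qed.

Lemma summableR_rate_sqr : summableR (fun x => pi x * m1 x ^+ 2).
Proof.
rewrite summableRE; move: M1_l2; rewrite /in_lp; apply: le_lt_trans.
apply: le_esum => x _; rewrite M1E/= ger0_norm; last first.
  by rewrite mulr_ge0// ?sqr_ge0// ltW// pi_gt0.
by rewrite -!EFinM lee_fin ger0_norm ?exit_rate_ge0// mulrC expr2.
Qed.

Lemma flow_ge0 p : 0 <= w p.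
Proof. by rewrite /w mulr_ge0 ?off_diag_ge0// ltW// pi_gt0. Qed.

Lemma flow_sym p : w (p.2, p.1) = w p.
Proof.
rewrite /w /kk/=; case: p => x y /=; rewrite eq_sym; case: ifP => _.
  by rewrite !mulr0.
exact: pi_db.
Qed.

Lemma flow_mulr_ge0 p (c : R) : 0 <= c -> 0 <= w p * c.
Proof. exact/mulr_ge0/flow_ge0. Qed.

(** Summing over the second end point turns w (1 + m1 p.1) into pi (m1 + m1^2), summable because M1
    is in l^2(mu); the term in m1 p.2 follows by the symmetry of the flow. *)
Lemma summableR_flow_rate : summableR (fun p => w p * (1 + m1 p.1 + m1 p.2)).
Proof.
have S1 : summableR (fun p : X * X => w p * (1 + m1 p.1)).
  have S x : summableR (fun y => w (x, y) * (1 + m1 x)).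
    apply: (@le_summableR _ _ _ (fun y => (pi x * (1 + m1 x)) * kk x y)).
      move=> y; rewrite ger0_norm ?flow_mulr_ge0 ?addr_ge0 ?exit_rate_ge0//.
      by rewrite /w/=; lra.
    by apply: summableRZ; exact: summableR_off_diag.
  apply: summableR_pair => //=.
    by move=> z; rewrite flow_mulr_ge0 ?addr_ge0 ?exit_rate_ge0.
  apply: (@le_summableR _ _ _ (fun x => pi x + 2 * (pi x * m1 x ^+ 2))); last first.
    by apply: summableRD; [exact: summableR_pi|by apply: summableRZ;
      exact: summableR_rate_sqr].
  move=> x; rewrite /w/=.
  under eq_fun do rewrite mulrAC.
  rewrite rsumZ; last exact: summableR_off_diag.
  rewrite rsum_off_diag ger0_norm; last first.
    by rewrite !mulr_ge0 ?addr_ge0 ?exit_rate_ge0// ltW// pi_gt0.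
  have h1 := mulr_ge0 (ltW (pi_gt0 x)) (sqr_ge0 (m1 x - 1)).
  have h2 := mulr_ge0 (ltW (pi_gt0 x)) (sqr_ge0 (m1 x)).
  have := pi_gt0 x; lra.
have S2 : summableR (fun p : X * X => w p * (1 + m1 p.2)).
  have /= := summableR_swap S1; apply: le_summableR => -[x y] /=.
  rewrite -(flow_sym (x, y))/= ger0_norm//.
  by rewrite flow_mulr_ge0 ?addr_ge0 ?exit_rate_ge0.
have := summableRD S1 S2; apply: le_summableR => p.
have h1 := exit_rate_ge0 p.1; have h2 := exit_rate_ge0 p.2; have h3 := flow_ge0 p.
rewrite ger0_norm; first by rewrite -mulrDr; apply: ler_wpM2l => //; lra.
by rewrite flow_mulr_ge0 ?addr_ge0 ?exit_rate_ge0.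
Qed.

(** The growth allowed for functions on X; [dominated] is its counterpart on edges and guarantees
    summability against the flow. Two such functions cannot be multiplied freely: in every product
    below one factor is bounded. *)
Definition rate_bounded (a : X -> R) :=
  exists C, forall x, `|a x| <= C * (1 + m1 x).

Definition dominated (F : X * X -> R) :=
  exists C, forall p, `|F p| <= C * (1 + m1 p.1 + m1 p.2).

Definition flow_sum (F : X * X -> R) := rsum (fun p => w p * F p).

Definition grad (b : X -> R) (p : X * X) := b p.2 - b p.1.

Local Notation L := (markov_generator k).

Lemma rate_bounded_cst (a : X -> R) (C : R) : (forall x, `|a x| <= C) ->
  rate_bounded a.
Proof.
move=> aC; exists C => x; apply: (le_trans (aC x)).
by rewrite ler_peMr ?lerDl ?exit_rate_ge0// (le_trans _ (aC x)).
Qed.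

Lemma rate_boundedD a b : rate_bounded a -> rate_bounded b ->
  rate_bounded (fun x => a x + b x).
Proof.
move=> [C aC] [D bD]; exists (C + D) => x.
by rewrite mulrDl (le_trans (ler_normD _ _))// lerD.
Qed.

Lemma rate_boundedN a : rate_bounded a -> rate_bounded (fun x => - a x).
Proof. by move=> [C aC]; exists C => x; rewrite normrN. Qed.

Lemma rate_boundedB a b : rate_bounded a -> rate_bounded b ->
  rate_bounded (fun x => a x - b x).
Proof. by move=> ra /rate_boundedN; exact: rate_boundedD. Qed.

Lemma rate_boundedM a b (C : R) : (forall x, `|a x| <= C) -> rate_bounded b ->
  rate_bounded (fun x => a x * b x).
Proof.
move=> aC [D bD]; exists (C * D) => x.
by rewrite normrM -mulrA ler_pM.
Qed.

Lemma dominatedD F G : dominated F -> dominated G -> dominated (fun p => F p + G p).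
Proof.
move=> [C FC] [D GD]; exists (C + D) => p.
by rewrite mulrDl (le_trans (ler_normD _ _))// lerD.
Qed.

Lemma dominatedN F : dominated F -> dominated (fun p => - F p).
Proof. by move=> [C FC]; exists C => p; rewrite normrN. Qed.

Lemma dominatedB F G : dominated F -> dominated G -> dominated (fun p => F p - G p).
Proof. by move=> ? /dominatedN; exact: dominatedD. Qed.

Lemma dominatedM (a F : X * X -> R) (C : R) : (forall p, `|a p| <= C) ->
  dominated F -> dominated (fun p => a p * F p).
Proof.
move=> aC [D FD]; exists (C * D) => p.
by rewrite normrM -mulrA ler_pM.
Qed.

Lemma dominatedMr (a F : X * X -> R) (C : R) : (forall p, `|a p| <= C) ->
  dominated F -> dominated (fun p => F p * a p).
Proof.
by move=> aC /(dominatedM aC); under eq_fun do rewrite mulrC.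
Qed.

Lemma dominated_fst a : rate_bounded a -> dominated (fun p => a p.1).
Proof.
move=> [C aC]; exists C => p; apply: (le_trans (aC _)).
rewrite [leRHS]mulrDr lerDl mulr_ge0// ?exit_rate_ge0//.
have := le_trans (normr_ge0 _) (aC p.1); rewrite pmulr_lge0//.
by rewrite ltr_pwDl// exit_rate_ge0.
Qed.

Lemma dominated_swap F : dominated F -> dominated (fun p => F (p.2, p.1)).
Proof. by move=> [C FC]; exists C => p; rewrite addrAC; exact: FC. Qed.

Lemma dominated_snd a : rate_bounded a -> dominated (fun p => a p.2).
Proof. by move=> /dominated_fst/dominated_swap. Qed.

Lemma dominated_grad a : rate_bounded a -> dominated (grad a).
Proof.
by move=> h; apply: dominatedB; [exact: dominated_snd|exact: dominated_fst].
Qed.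

Lemma grad_bounded a (C : R) : (forall x, `|a x| <= C) ->
  forall p, `|grad a p| <= 2 * C.
Proof.
move=> aC p; rewrite /grad mulr_natl mulr2n (le_trans (ler_normB _ _))//.
by rewrite lerD.
Qed.

Lemma summableR_flow F : dominated F -> summableR (fun p => w p * F p).
Proof.
move=> [C FC].
apply: (@le_summableR _ _ _ (fun p => C * (w p * (1 + m1 p.1 + m1 p.2)))).
  move=> p; rewrite normrM (ger0_norm (flow_ge0 _)) mulrCA.
  by apply: ler_wpM2l; [exact: flow_ge0|exact: FC].
apply: summableRZ; exact: summableR_flow_rate.
Qed.

Lemma flow_sumD F G : dominated F -> dominated G ->
  flow_sum (fun p => F p + G p) = flow_sum F + flow_sum G.
Proof.
move=> FF GG; rewrite /flow_sum -rsumD; [|exact: summableR_flow..].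
by congr rsum; apply/funext => p; rewrite mulrDr.
Qed.

Lemma flow_sumN F : dominated F -> flow_sum (fun p => - F p) = - flow_sum F.
Proof.
move=> FF; rewrite /flow_sum -rsumN; last exact: summableR_flow.
by congr rsum; apply/funext => p; rewrite mulrN.
Qed.

Lemma flow_sumB F G : dominated F -> dominated G ->
  flow_sum (fun p => F p - G p) = flow_sum F - flow_sum G.
Proof.
by move=> FF GG; rewrite flow_sumD ?flow_sumN//; exact: dominatedN.
Qed.

Lemma flow_sum_swap F : flow_sum (fun p => F (p.2, p.1)) = flow_sum F.
Proof.
rewrite /flow_sum -rsum_swap; congr rsum; apply/funext => p/=.
by rewrite flow_sym; case: p.
Qed.

(* Summation by parts: exchanging the end points of each edge. *)
Lemma flow_sum_fst_grad a b : dominated (fun p => a p.1 * grad b p) ->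
  flow_sum (fun p => grad a p * grad b p) =
    - 2 * flow_sum (fun p => a p.1 * grad b p).
Proof.
move=> d1; have d2 := dominated_swap d1.
have e : flow_sum (fun p => a p.2 * grad b p) =
  - flow_sum (fun p => a p.1 * grad b p).
  rewrite -[in RHS]flow_sum_swap/= -flow_sumN//; congr flow_sum; apply/funext => p.
  by rewrite /grad/= -mulrN opprB.
have d3 : dominated (fun p => a p.2 * grad b p).
  move/dominatedN : d2; rewrite /grad/=.
  by under eq_fun do rewrite -mulrN opprB.
transitivity (flow_sum (fun p => a p.2 * grad b p - a p.1 * grad b p)).
  by congr flow_sum; apply/funext => p; rewrite {1}/grad mulrBl.
by rewrite flow_sumB// e; ring.
Qed.

Lemma rsum_rates (F : X -> R) x : F x = 0 ->
  rsum (fun y => k x y * F y) = rsum (fun y => kk x y * F y).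
Proof.
move=> F0; congr rsum; apply/funext => y; rewrite /kk; case: eqP => // ->.
by rewrite F0 !mulr0.
Qed.

Lemma generatorE b x : L b x = rsum (fun y => kk x y * (b y - b x)).
Proof. by rewrite /markov_generator (@rsum_rates (fun y => b y - b x) x)// subrr.
  Qed.

(** The sum of k(x,y) m1(y) over y is M2(x). Its finiteness lets [L] act on functions that are only
    [rate_bounded], such as [L rho] and Psi. *)
Lemma summableR_off_diagM x a : rate_bounded a -> summableR (fun y => kk x y * a y).
Proof.
move=> [C aC].
apply: (@le_summableR _ _ _ (fun y => C * (kk x y + kk x y * m1 y))).
  move=> y; rewrite normrM (ger0_norm (off_diag_ge0 _ _)).
  rewrite [leRHS](_ : _ = kk x y * (C * (1 + m1 y))); last by ring.
  by apply: ler_wpM2l; [exact: off_diag_ge0|exact: aC].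
by apply: summableRZ; apply: summableRD;
  [exact: summableR_off_diag|exact: summableR_off_diag_rate].
Qed.

Lemma rate_bounded_shift a (c : R) : rate_bounded a ->
  rate_bounded (fun y => a y - c).
Proof.
move=> ra; apply: rate_boundedB => //.
by apply: (@rate_bounded_cst (cst c) `|c|) => x.
Qed.

Lemma summableR_off_diag_grad x b : rate_bounded b ->
  summableR (fun y => kk x y * (b y - b x)).
Proof. by move=> /(rate_bounded_shift (b x)); exact: summableR_off_diagM. Qed.

Lemma rate_bounded_generator b (C : R) : (forall x, `|b x| <= C) ->
  forall x, `|L b x| <= 2 * C * m1 x.
Proof.
move=> bC x; rewrite generatorE.
have sb : summableR (fun y => kk x y * (b y - b x)).
  exact/summableR_off_diag_grad/(rate_bounded_cst bC).
apply: (le_trans (normr_rsum sb)).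
rewrite -rsum_off_diag -rsumZ; last exact: summableR_off_diag.
apply: le_rsum; [exact: summableR_norm|by apply: summableRZ;
  exact: summableR_off_diag|].
move=> y; rewrite normrM (ger0_norm (off_diag_ge0 _ _)) mulrC.
by apply: ler_wpM2r; [exact: off_diag_ge0|exact: (grad_bounded bC (x, y))].
Qed.

Lemma rate_bounded_L b (C : R) : (forall x, `|b x| <= C) -> rate_bounded (L b).
Proof.
move=> bC; exists (2 * C) => x; apply: le_trans (rate_bounded_generator bC x) _.
rewrite ler_wpM2l ?lerDr// mulr_ge0//; exact: le_trans (bC x).
Qed.

Lemma flow_sum_generator a b : rate_bounded b ->
  dominated (fun p => a p.1 * grad b p) ->
  flow_sum (fun p => a p.1 * grad b p) = rsum (fun x => pi x * a x * L b x).
Proof.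
move=> rb d; rewrite /flow_sum rsum_pair; last exact: summableR_flow.
congr rsum; apply/funext => x; rewrite generatorE -rsumZ;
  last exact: summableR_off_diag_grad.
by congr rsum; apply/funext => y; rewrite /w /grad/=; ring.
Qed.

Lemma summableR_pi_generator a b : rate_bounded b ->
  dominated (fun p => a p.1 * grad b p) ->
  summableR (fun x => pi x * a x * L b x).
Proof.
move=> rb d; have /= := summableR_rsum_slice (summableR_flow d);
  congr (is_true (summableR _)).
apply/funext => x; rewrite generatorE -rsumZ; last exact: summableR_off_diag_grad.
by congr rsum; apply/funext => y; rewrite /w /grad/=; ring.
Qed.

Lemma bounded_fun_norm (f : X -> R) (C : R) : (forall x, `|f x| <= C) ->
  bounded_fun f.
Proof.
move=> fC; rewrite /= /bounded_near; near=> M => x _ /=.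
by apply: le_trans (fC x) _; near: M; exact/nbhs_pinfty_ge/num_real.
Unshelve. all: by end_near. Qed.

(** * Entropy dissipation *)
Section bounded_density.
Variables (rho : X -> R) (a b : R).
Hypothesis a_gt0 : 0 < a.
Hypothesis rho_ge : forall x, a <= rho x.
Hypothesis rho_le : forall x, rho x <= b.

Let lr x := ln (rho x).
Let h := L rho.

Lemma rho_gt0 x : 0 < rho x. Proof. exact: lt_le_trans (rho_ge x). Qed.

Lemma rho_norm x : `|rho x| <= b.
Proof. by rewrite gtr0_norm ?rho_gt0. Qed.

Lemma rhoV_norm x : `|(rho x)^-1| <= a^-1.
Proof. by rewrite gtr0_norm ?invr_gt0 ?rho_gt0// lef_pV2// posrE rho_gt0. Qed.

Lemma ln_rho_norm x : `|ln (rho x)| <= `|ln a| + `|ln b|.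
Proof.
have h1 : ln a <= ln (rho x) by rewrite ler_ln ?posrE// rho_gt0.
have h2 : ln (rho x) <= ln b.
  by rewrite ler_ln ?posrE ?rho_gt0// (lt_le_trans (rho_gt0 x)).
have h3 := ler_norm (ln b); have h4 := ler_norm (- ln a); rewrite normrN in h4.
have h5 := normr_ge0 (ln a); have h6 := normr_ge0 (ln b).
by rewrite ler_norml; apply/andP; split; lra.
Qed.

Let rb_rho : rate_bounded rho. Proof. exact: rate_bounded_cst rho_norm. Qed.
Let rb_lr : rate_bounded lr. Proof. exact: rate_bounded_cst ln_rho_norm. Qed.
Let rb_h : rate_bounded h. Proof. exact: rate_bounded_L rho_norm. Qed.
Let rb_Llr : rate_bounded (L lr). Proof. exact: rate_bounded_L ln_rho_norm. Qed.
Let rb_h_rho : rate_bounded (fun x => (rho x)^-1 * h x).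
Proof. exact: rate_boundedM rhoV_norm rb_h. Qed.

Let expR_lr x y : expR (lr y - lr x) = (rho x)^-1 * rho y.
Proof. by rewrite expRD expRN !lnK ?posrE ?rho_gt0// mulrC. Qed.

(* [Upsilon (s - r) = expR (s - r) - 1 - (s - r)] summed against the rates: the
   exponential part is [L rho / rho], the linear one [L (ln rho)]. *)
Lemma Psi_ln x : Psi_Upsilon k lr x = (rho x)^-1 * h x - L lr x.
Proof.
have rx := rho_gt0 x.
rewrite /Psi_Upsilon (@rsum_rates (fun y => Upsilon (lr y - lr x)) x); last first.
  by rewrite /Upsilon subrr expR0 !subrr.
rewrite /h !generatorE -rsumZ; last exact: summableR_off_diag_grad.
rewrite -rsumB; [|by apply: summableRZ;
  exact: summableR_off_diag_grad|exact: summableR_off_diag_grad].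
congr rsum; apply/funext => y; rewrite /Upsilon expR_lr.
by field; rewrite gt_eqF.
Qed.

Lemma rb_Psi : rate_bounded (Psi_Upsilon k lr).
Proof.
rewrite (_ : Psi_Upsilon k lr = fun x => (rho x)^-1 * h x - L lr x).
  exact: rate_boundedB.
by apply/funext => x; exact: Psi_ln.
Qed.

(** Upsilon' (ln rho y - ln rho x) = rho y / rho x - 1, and the factor rho x clears the
    denominator. *)
Lemma B_ln x : rho x * B_dUpsilon k lr (L lr) x =
  rsum (fun y => kk x y * ((rho y - rho x) * (L lr y - L lr x))).
Proof.
have rx := rho_gt0 x.
have e : B_dUpsilon k lr (L lr) x =
    rsum (fun y => kk x y * (((rho x)^-1 * (rho y - rho x)) * (L lr y - L lr x))).
  rewrite -(@rsum_rates (fun y => ((rho x)^-1 * (rho y - rho x)) * (L lr y - L lr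
    x)) x).
    congr rsum; apply/funext => y; rewrite derive1_Upsilon expR_lr.
    by field; rewrite gt_eqF.
  by rewrite subrr mulr0 mul0r.
rewrite e -rsumZ; last first.
  apply: summableR_off_diagM; apply: (@rate_boundedM _ _ (a^-1 * (2 * b))).
    move=> y; rewrite normrM ler_pM ?rhoV_norm//;
      exact: (grad_bounded rho_norm (x, y)).
  exact: rate_bounded_shift.
congr rsum; apply/funext => y; by field; rewrite gt_eqF.
Qed.

Definition fisher := 2^-1 * flow_sum (fun p => grad rho p * grad lr p).

(* The time derivative of [fisher] at rho along [rho' = L rho]. *)
Definition fisher_rate := 2^-1 * flow_sum (fun p => grad h p * grad lr p +
  grad rho p * grad (fun x => (rho x)^-1 * h x) p).

Let dMl u v (C : R) : (forall x, `|u x| <= C) -> rate_bounded v ->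
  dominated (fun p => grad u p * grad v p).
Proof.
move=> uC rv; apply: (dominatedM (grad_bounded uC)); exact: dominated_grad.
Qed.

Let dMr u v (C : R) : rate_bounded u -> (forall x, `|v x| <= C) ->
  dominated (fun p => grad u p * grad v p).
Proof.
move=> ru vC; apply: (dominatedMr (grad_bounded vC)); exact: dominated_grad.
Qed.

Let fMl u v (C : R) : (forall x, `|u x| <= C) -> rate_bounded v ->
  dominated (fun p => u p.1 * grad v p).
Proof.
by move=> uC rv; apply: dominatedM (dominated_grad rv) => p; exact: uC.
Qed.

Let fMr u v (C : R) : rate_bounded u -> (forall x, `|v x| <= C) ->
  dominated (fun p => u p.1 * grad v p).
Proof.
move=> ru vC; apply: (dominatedMr (grad_bounded vC)); exact: dominated_fst.
Qed.

(** Symmetry of [L] with respect to pi: both sides equal -2 times the sum of pi (L rho)(L ln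
    rho). *)
Lemma flow_sum_grad_generator : flow_sum (fun p => grad rho p * grad (L lr) p) =
  flow_sum (fun p => grad h p * grad lr p).
Proof.
have e1 : flow_sum (fun p => grad (L lr) p * grad rho p) =
    -2 * rsum (fun x => pi x * L lr x * h x).
  rewrite flow_sum_fst_grad; last exact: fMr _ rho_norm.
  by rewrite flow_sum_generator//; exact: fMr _ rho_norm.
have e2 : flow_sum (fun p => grad h p * grad lr p) =
    -2 * rsum (fun x => pi x * h x * L lr x).
  rewrite flow_sum_fst_grad; last exact: fMr _ ln_rho_norm.
  by rewrite flow_sum_generator//; exact: fMr _ ln_rho_norm.
rewrite e2; under eq_fun do rewrite mulrC; rewrite e1; congr (_ * rsum _).
by apply/funext => x; rewrite mulrAC.
Qed.

Let d1 : dominated (fun p => cst 1 p.1 * grad rho p).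
Proof. by apply: (@fMl (cst 1) rho 1) => // x; rewrite normr1. Qed.

Let d2 : dominated (fun p => rho p.1 * grad lr p).
Proof. exact: fMl rho_norm rb_lr. Qed.

Let pi_Psi : (fun x => pi x * rho x * Psi_Upsilon k lr x) =
  fun x => pi x * 1 * h x - pi x * rho x * L lr x.
Proof.
by apply/funext => x; rewrite Psi_ln; field; rewrite gt_eqF//; exact: rho_gt0.
Qed.

Lemma summableR_pi_Psi : summableR (fun x => pi x * rho x * Psi_Upsilon k lr x).
Proof.
rewrite pi_Psi; apply: summableRB; first exact: (summableR_pi_generator rb_rho d1).
exact: (summableR_pi_generator rb_lr d2).
Qed.

(** By [Psi_ln] the summand is pi L rho - pi rho L (ln rho). The first term sums to 0, as summation
    by parts against the constant 1 shows; the second gives the Fisher information by parts. *)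
Lemma rsum_Psi : rsum (fun x => pi x * rho x * Psi_Upsilon k lr x) = fisher.
Proof.
have s1 := summableR_pi_generator rb_rho d1;
  have s2 := summableR_pi_generator rb_lr d2.
have e1 : rsum (fun x => pi x * 1 * h x) = 0.
  rewrite -[LHS](flow_sum_generator rb_rho d1).
  have := flow_sum_fst_grad d1.
  rewrite (_ : (fun p => _ * _) = fun p : X * X => 0); last first.
    by apply/funext => p; rewrite /grad subrr mul0r.
  rewrite [LHS](_ : _ = 0); first by lra.
  rewrite /flow_sum (@rsum_fset _ _ fset0) ?big_seq_fset0// => p _.
  by rewrite mulr0.
rewrite pi_Psi rsumB// e1 sub0r -flow_sum_generator//.
by rewrite /fisher [X in _ = _ * X]flow_sum_fst_grad//; lra.
Qed.

(* [fisher_rate = - 2 sum pi rho Psi_2], to which CD applies at each point. *)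
Lemma fisher_rate_le (kappa : R) : CD_Upsilon k kappa ->
  fisher_rate <= - (2 * kappa) * fisher.
Proof.
move=> CD.
have bl : bounded_fun lr by exact: bounded_fun_norm ln_rho_norm.
pose A := flow_sum (fun p => grad rho p * grad (L lr) p).
have dA : dominated (fun p => grad rho p * grad (L lr) p).
  exact: dMl rho_norm rb_Llr.
have dP : dominated (fun p => rho p.1 * grad (Psi_Upsilon k lr) p).
  exact: fMl rho_norm rb_Psi.
have sA := summableR_flow dA.
have sP := summableR_pi_generator rb_Psi dP.
(* The right-hand side is the sum of 2 pi rho Psi_2: its first term is the sum of pi rho L Psi, and
   summing A over the second end point leaves pi rho B. *)
have main : 2 * kappa * fisher <=
    flow_sum (fun p => rho p.1 * grad (Psi_Upsilon k lr) p) - A.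
  rewrite flow_sum_generator//; last exact: rb_Psi.
  rewrite /A /flow_sum (rsum_pair sA) -(rsumB sP (summableR_rsum_slice sA)).
  rewrite -rsum_Psi -rsumZ; last exact: summableR_pi_Psi.
  apply: le_rsum.
  - by apply: summableRZ; exact: summableR_pi_Psi.
  - exact: summableRB sP (summableR_rsum_slice sA).
  - move=> x.
    have -> : rsum (fun y => w (x, y) * (grad rho (x, y) * grad (L lr) (x, y))) =
        pi x * (rho x * B_dUpsilon k lr (L lr) x).
      rewrite B_ln -rsumZ; last first.
        apply: summableR_off_diagM; apply: (@rate_boundedM _ _ (2 * b)).
          by move=> y; exact: (grad_bounded rho_norm (x, y)).
        exact: rate_bounded_shift.
      by congr rsum; apply/funext => y; rewrite /w /grad/=; ring.
    have c0 : 0 <= 2 * (pi x * rho x).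
      by rewrite !mulr_ge0// ltW// ?pi_gt0// rho_gt0.
    have := ler_wpM2l c0 (CD _ bl x); rewrite /Psi2_Upsilon; lra.
have d3 : dominated (fun p => grad h p * grad lr p) by exact: dMr rb_h ln_rho_norm.
have d4 : dominated (fun p => grad rho p * grad (fun x => (rho x)^-1 * h x) p).
  exact: dMl rho_norm rb_h_rho.
have e : flow_sum (fun p => grad rho p * grad (Psi_Upsilon k lr) p) =
    flow_sum (fun p => grad rho p * grad (fun x => (rho x)^-1 * h x) p) - A.
  rewrite -flow_sumB//; congr flow_sum; apply/funext => p.
  by rewrite /grad !Psi_ln; ring.
have eA : A = flow_sum (fun p => grad h p * grad lr p).
  exact: flow_sum_grad_generator.
(* Let P be the first term of [main] and V the flow sum of grad rho times grad (L rho / rho). By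
   parts V - A = -2 P, so [fisher_rate] = (A + V) / 2 = A - P, the opposite of the right-hand side
   of [main]. *)
have := flow_sum_fst_grad dP; rewrite e => e'.
rewrite /fisher_rate flow_sumD// -eA; lra.
Qed.

End bounded_density.

Lemma summableR_pi_rate : summableR (fun x => pi x * m1 x).
Proof.
apply: (@le_summableR _ _ _ (fun x => pi x + pi x * m1 x ^+ 2)); last first.
  by apply: summableRD; [exact: summableR_pi|exact: summableR_rate_sqr].
move=> x; rewrite ger0_norm; last by rewrite mulr_ge0 ?exit_rate_ge0// ltW// pi_gt0.
have h1 := mulr_ge0 (ltW (pi_gt0 x)) (sqr_ge0 (m1 x - 1)).
have h2 := mulr_ge0 (ltW (pi_gt0 x)) (sqr_ge0 (m1 x)).
have := pi_gt0 x; lra.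
Qed.

Lemma dominated_cst (C : R) : dominated (cst C).
Proof.
exists `|C| => p; rewrite ler_peMr// -addrA lerDl addr_ge0// exit_rate_ge0//.
Qed.

(** * Long-time behaviour of a bounded positive solution of u' = L u *)

Section heat_flow.
Variables (u : R -> X -> R) (a b kappa : R).
Hypothesis k_irr : irreducible_rates k.
Hypothesis a_gt0 : 0 < a.
Hypothesis b_ge0 : 0 <= b.
Hypothesis u_ge : forall t x, a <= u t x.
Hypothesis u_le : forall t x, u t x <= b.
Hypothesis u_cont : forall x, continuous (u ^~ x).
Hypothesis u_der : forall (t : R) x, 0 < t -> is_derive t 1 (u ^~ x) (L (u t) x).
Hypothesis u0_mass : rsum (fun x => u 0 x * pi x) = 1.
Hypothesis kappa_gt0 : 0 < kappa.
Hypothesis CD : CD_Upsilon k kappa.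

Let u_gt0 t x : 0 < u t x. Proof. exact: lt_le_trans (u_ge t x). Qed.
Let u_norm t x : `|u t x| <= b.
Proof. exact: rho_norm a_gt0 (u_ge t) (u_le t) x. Qed.
Let c := `|ln a| + `|ln b|.
Let c_ge0 : 0 <= c. Proof. exact: addr_ge0. Qed.
Let ln_norm t x : `|ln (u t x)| <= c.
Proof. exact: ln_rho_norm a_gt0 (u_ge t) (u_le t) x. Qed.
Let uV_norm t x : `|(u t x)^-1| <= a^-1.
Proof. exact: rhoV_norm a_gt0 (u_ge t) x. Qed.
Let Lu_norm t x : `|L (u t) x| <= 2 * b * m1 x.
Proof. exact: rate_bounded_generator (u_norm t) x. Qed.

Definition entropy_along t := rsum (fun x => u t x * ln (u t x) * pi x).

Let cont_ln x : continuous (fun t => ln (u t x)).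
Proof.
move=> t; apply: (@continuous_comp _ _ _ (u ^~ x) (@ln R)); first exact: u_cont.
exact: continuous_ln.
Qed.

Let summableR_entropy t : summableR (fun x => u t x * ln (u t x) * pi x).
Proof.
apply: (@le_summableR _ _ _ (fun x => b * c * pi x)); last by apply: summableRZ;
  exact: summableR_pi.
move=> x; rewrite !normrM ler_pM ?mulr_ge0//; first by rewrite ler_pM.
by rewrite ger0_norm// ltW// pi_gt0.
Qed.

Lemma entropy_along_continuous : continuous entropy_along.
Proof.
move=> t; rewrite /continuous_at /entropy_along.
have bd s x : `|u s x * ln (u s x) * pi x| <= b * c * pi x.
  rewrite !normrM ler_pM ?mulr_ge0//; first by rewrite ler_pM.
  by rewrite ger0_norm// ltW// pi_gt0.
apply: (@rsum_cvg _ _ _ _ _ _ _ (fun x => b * c * pi x)) => //.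
- by apply: summableRZ; exact: summableR_pi.
- by apply: nearW => s x; exact: bd.
- move=> x; apply: cvgM; last exact: cvg_cst.
  by apply: cvgM; [exact: u_cont|exact: cont_ln].
Qed.

Let dln (s : R) x : 0 < s ->
  is_derive s 1 (fun s => ln (u s x)) ((u s x)^-1 * L (u s) x).
Proof.
move=> s0; have h1 := is_derive1_ln (u_gt0 s x); have h2 := u_der x s0.
exact: (is_derive1_comp h1 h2).
Qed.

(** The derivative of u ln u is (ln u + 1) L u, dominated by a multiple of m1; the constant 1
    disappears in the gradient when summing by parts. *)
Lemma entropy_along_derive (t : R) : 0 < t ->
  is_derive t 1 entropy_along (- fisher (u t)).
Proof.
move=> t0; pose f' s x := pi x * (ln (u s x) + 1) * L (u s) x.
have -> : - fisher (u t) = rsum (f' t).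
  have l1 x : `|ln (u t x) + 1| <= c + 1.
    by rewrite (le_trans (ler_normD _ _))// normr1 lerD.
  have ru := rate_bounded_cst (u_norm t).
  have d : dominated (fun p => (ln (u t p.1) + 1) * grad (u t) p).
    by apply: dominatedM (dominated_grad ru) => p; exact: l1.
  have := @flow_sum_fst_grad (fun x => ln (u t x) + 1) (u t) d.
  rewrite (@flow_sum_generator (fun x => ln (u t x) + 1) _ ru d) /fisher => e.
  rewrite (_ : (fun p => _) =
    fun p => grad (fun x => ln (u t x) + 1) p * grad (u t) p).
    by rewrite e; lra.
  by apply/funext => p; rewrite /grad/=; ring.
apply: (@is_derive_rsum _ _ _ _ (fun x => (c + 1) * (2 * b) * (pi x * m1 x)) _ t)
  => //.
- by apply: summableRZ; exact: summableR_pi_rate.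
- move=> s x; rewrite ltr_norml => /andP[st _]; have s0 : 0 < s by lra.
  have h1 := u_der x s0; have h2 := dln x s0.
  apply: is_derive_eq; rewrite /f' /GRing.scale/= mulr0 add0r.
  by field; rewrite gt_eqF.
- move=> s x _; rewrite /f' !normrM (gtr0_norm (pi_gt0 x)).
  rewrite (_ : _ * (pi x * m1 x) = pi x * (c + 1) * (2 * b * m1 x)); last by ring.
  rewrite ler_pM ?mulr_ge0 ?(ltW (pi_gt0 x))//.
  rewrite ler_wpM2l ?(ltW (pi_gt0 x))//.
  by rewrite (le_trans (ler_normD _ _))// normr1 lerD.
Qed.

Lemma fisher_along_continuous : continuous (fun t => fisher (u t)).
Proof.
move=> t; apply: cvgM; first exact: cvg_cst.
have bd s p : `|w p * (grad (u s) p * grad (fun x => ln (u s x)) p)| <=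
    w p * cst (2 * b * (2 * c)) p.
  rewrite normrM (ger0_norm (flow_ge0 _)); apply: ler_wpM2l; first exact: flow_ge0.
  by rewrite normrM ler_pM ?(grad_bounded (u_norm s))// (grad_bounded (ln_norm s)).
apply: (rsum_cvg (summableR_flow (dominated_cst (2 * b * (2 * c))))).
- by apply: nearW => s p; exact: bd.
- by move=> p; exact: bd.
- move=> p; apply: cvgM; first exact: cvg_cst.
  by apply: cvgM; apply: cvgB; [exact: u_cont..|exact: cont_ln|exact: cont_ln].
Qed.

Let grad_rate_bounded (f : X -> R) (C : R) p : (forall x, `|f x| <= C * m1 x) ->
  `|grad f p| <= C * (m1 p.1 + m1 p.2).
Proof.
move=> fC; rewrite /grad (le_trans (ler_normB _ _))// mulrDr addrC lerD//.
Qed.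

Lemma fisher_along_derive (t : R) : 0 < t ->
  is_derive t 1 (fun t => fisher (u t)) (fisher_rate (u t)).
Proof.
move=> t0.
pose f s p := w p * (grad (u s) p * grad (fun x => ln (u s x)) p).
pose f' s p := w p * (grad (L (u s)) p * grad (fun x => ln (u s x)) p +
  grad (u s) p * grad (fun x => (u s x)^-1 * L (u s) x) p).
(* One summand per term of the product rule: grad (L u) is at most 2 b (m1 + m1) and grad (ln u) at
   most 2 c; grad u is at most 2 b and grad (L u / u) at most a^-1 (2 b) (m1 + m1). *)
pose C := 2 * b * (2 * c) + 2 * b * (a^-1 * (2 * b)).
have C0 : 0 <= C by rewrite addr_ge0 ?mulr_ge0 ?invr_ge0// ltW.
suff h : is_derive t 1 (fun s => rsum (f s)) (rsum (f' t)).
  exact: (@is_deriveZ _ _ _ _ 2^-1 _ _ _ h).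
apply: (is_derive_rsum t0 (summableRZ C summableR_flow_rate)).
- move=> s _; apply: summableR_flow; apply: (dominatedM (grad_bounded (u_norm s))).
  exact/dominated_grad/(rate_bounded_cst (ln_norm s)).
- move=> s p; rewrite ltr_norml => /andP[st _]; have s0 : 0 < s by lra.
  have h1 := u_der p.1 s0; have h2 := u_der p.2 s0.
  have h3 := dln p.1 s0; have h4 := dln p.2 s0.
  rewrite /f /f' /grad.
  apply: is_derive_eq; rewrite /GRing.scale/=.
  by ring.
- move=> s p _; rewrite normrM (ger0_norm (flow_ge0 _)) mulrCA.
  apply: ler_wpM2l; first exact: flow_ge0.
  have m0 : 0 <= m1 p.1 + m1 p.2 by rewrite addr_ge0 ?exit_rate_ge0.
  apply: (@le_trans _ _ (C * (m1 p.1 + m1 p.2))); last first.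
    by apply: ler_wpM2l => //; lra.
  have g1 := grad_rate_bounded p (Lu_norm s).
  have g2 := grad_bounded (ln_norm s) p.
  have g3 := grad_bounded (u_norm s) p.
  have g4 : `|grad (fun x => (u s x)^-1 * L (u s) x) p| <=
      a^-1 * (2 * b) * (m1 p.1 + m1 p.2).
    apply: grad_rate_bounded => x.
    by rewrite normrM -mulrA ler_pM.
  rewrite (le_trans (ler_normD _ _))// /C [leRHS]mulrDl lerD//.
    by rewrite normrM mulrAC ler_pM.
  by rewrite normrM -mulrA ler_pM.
Qed.

(** Gronwall's inequality with integrating factor exp (2 kappa s), used for the Fisher information
    and again for the entropy. *)
Let decay (A A' : R -> R) : continuous A ->
  (forall s : R, 0 < s -> is_derive s 1 A (A' s)) ->
  (forall s : R, 0 < s -> A' s <= - (2 * kappa) * A s) ->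
  forall s t : R, 0 <= s -> s <= t ->
    expR (2 * kappa * t) * A t <= expR (2 * kappa * s) * A s.
Proof.
move=> cA dA A'le.
have dE (s : R) : is_derive s 1 (fun s => expR (2 * kappa * s)) (2 * kappa * expR
  (2 * kappa * s)).
  apply: is_derive_eq; rewrite /GRing.scale/=; ring.
have cE : continuous (fun s : R => expR (2 * kappa * s)).
  move=> s; have ds := dE s.
  by apply: differentiable_continuous; apply/derivable1_diffP.
apply: (@le0_derive_homo _ _ (fun s => expR (2 * kappa * s) * (A' s + 2 * kappa * A
  s))).
- by move=> s; apply: cvgM; [exact: cE|exact: cA].
- move=> s s0; have h1 := dE s; have h2 := dA s s0.
  by apply: is_derive_eq; rewrite /GRing.scale/=; ring.
- move=> s s0; rewrite mulr_ge0_le0 ?expR_ge0//; have := A'le s s0; lra.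
Qed.

Let fisher_term_ge t p : w p * (b^-1 * grad (u t) p ^+ 2) <=
  w p * (grad (u t) p * grad (fun x => ln (u t x)) p).
Proof.
apply: ler_wpM2l; first exact: flow_ge0.
have b0 : 0 < b by exact: lt_le_trans (u_le t p.1).
rewrite ler_pdivrMl//; exact: sqr_diff_le.
Qed.

Let fisher_term_ge0 t p : 0 <= w p * (grad (u t) p * grad (fun x => ln (u t x)) p).
Proof.
apply: le_trans (fisher_term_ge t p); apply: flow_mulr_ge0.
by rewrite mulr_ge0 ?invr_ge0 ?sqr_ge0.
Qed.

Lemma fisher_ge0 t : 0 <= fisher (u t).
Proof. by rewrite mulr_ge0// rsum_ge0. Qed.

Lemma fisher_decay t : 0 <= t ->
  fisher (u t) <= expR (- (2 * kappa * t)) * fisher (u 0).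
Proof.
move=> t0; have h := decay fisher_along_continuous fisher_along_derive.
have := h _ 0 t (lexx 0) t0; rewrite mulr0 expR0 mul1r => h'.
rewrite expRN mulrC ler_pdivlMr ?expR_gt0// mulrC; apply: h' => s s0.
exact: (fisher_rate_le a_gt0 (u_ge s) (u_le s) CD).
Qed.

Lemma fisher_cvg0 : fisher (u t) @[t --> +oo] --> (0 : R).
Proof.
have k0 : 0 < 2 * kappa by rewrite mulr_gt0.
apply/cvgrPdist_le => e e0; near=> t.
have t0 : 0 < t by near: t; exact/nbhs_pinfty_gt/num_real.
(* This time suffices once the exponential is bounded below by 1 + 2 kappa t. *)
have te : fisher (u 0) / (2 * kappa * e) <= t.
  by near: t; exact/nbhs_pinfty_ge/num_real.
rewrite sub0r normrN ger0_norm ?fisher_ge0//.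
have kt : 0 < 2 * kappa * t by rewrite mulr_gt0.
have := fisher_decay (ltW t0); rewrite expRN ler_pdivlMl ?expR_gt0// => h1.
have h2 := ler_wpM2r (fisher_ge0 t) (expR_ge1Dx (2 * kappa * t)).
move: te; rewrite ler_pdivrMr ?mulr_gt0// => h3.
have h4 : 2 * kappa * t * fisher (u t) <= 2 * kappa * t * e.
  by have := fisher_ge0 t; lra.
by rewrite ler_pM2l in h4.
Unshelve. all: by end_near. Qed.

Let edge_cvg0 x y : 0 < k x y -> u t y - u t x @[t --> +oo] --> (0 : R).
Proof.
move=> kxy; have [->|xy] := eqVneq y x.
  by under eq_fun do rewrite subrr; exact: cvg_cst.
have b0 : 0 < b by exact: lt_le_trans (u_le 0 x).
have w0 : 0 < w (x, y) by rewrite /w /kk/= (negPf xy) mulr_gt0// pi_gt0.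
apply/cvgrPdist_le => e e0.
(* By [fisher_term_ge], a gradient of size at least e on this single edge already forces a Fisher
   information of at least d. *)
pose d := 2^-1 * (w (x, y) * (b^-1 * e ^+ 2)).
have d0 : 0 < d.
  by apply: mulr_gt0 => //; apply: mulr_gt0 w0 _;
    rewrite mulr_gt0 ?invr_gt0 ?exprn_gt0.
move/cvgrPdist_lt : fisher_cvg0 => /(_ _ d0) F.
near=> t; rewrite sub0r normrN leNgt; apply/negP => ge.
have : `|0 - fisher (u t)| < d by near: t.
apply/negP; rewrite -leNgt sub0r normrN ger0_norm ?fisher_ge0//.
have h := rsum_ge_term (x, y) (summableR_flow (dominatedM (grad_bounded (u_norm t))
  (dominated_grad (rate_bounded_cst (ln_norm t))))) (fisher_term_ge0 t).
apply: ler_wpM2l => //; apply: le_trans h;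
  apply: le_trans (fisher_term_ge t (x, y)).
apply: ler_wpM2l; first exact: ltW.
apply: ler_wpM2l; first by rewrite invr_ge0.
by rewrite -[leRHS]real_normK ?num_real// lerXn2r ?nnegrE ?(ltW e0)// ltW.
Unshelve. all: by end_near. Qed.

Let path_cvg0 x y : u t y - u t x @[t --> +oo] --> (0 : R).
Proof.
have [s [_ + <-]] := k_irr x y; elim: s x => [|z s ih] x /=.
  by move=> _; under eq_fun do rewrite subrr; exact: cvg_cst.
move=> /andP[xz /ih h].
have -> : (fun t => u t (last z s) - u t x) =
    fun t => (u t (last z s) - u t z) + (u t z - u t x).
  by apply/funext => t; rewrite addrA subrK.
by rewrite -[X in _ --> X](addr0 (0 : R)); apply: cvgD => //; exact: edge_cvg0.
Qed.

Let summableR_mass t : summableR (fun x => u t x * pi x).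
Proof.
apply: (@le_summableR _ _ _ (fun x => b * pi x)); last by apply: summableRZ;
  exact: summableR_pi.
by move=> x; rewrite normrM (gtr0_norm (pi_gt0 x)) ler_wpM2r// ltW// pi_gt0.
Qed.

(** The derivative of the mass is the sum of pi L u, which vanishes by parts against the constant 1;
    monotonicity is then applied to the mass and to its opposite. *)
Lemma mass_along t : 0 <= t -> rsum (fun x => u t x * pi x) = 1.
Proof.
move=> t0; pose M s := rsum (fun x => u s x * pi x).
have cM : continuous M.
  move=> s; apply: (@rsum_cvg _ _ _ _ _ _ _ (fun x => b * pi x)).
  - by apply: summableRZ; exact: summableR_pi.
  - apply: nearW => r x.
    by rewrite normrM (gtr0_norm (pi_gt0 x)) ler_wpM2r// ltW// pi_gt0.
  - by move=> x; rewrite normrM (gtr0_norm (pi_gt0 x)) ler_wpM2r// ltW// pi_gt0.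
  - by move=> x; apply: cvgM; [exact: u_cont|exact: cvg_cst].
have dM (s : R) : 0 < s -> is_derive s 1 M 0.
  move=> s0.
  have d : dominated (fun p => cst 1 p.1 * grad (u s) p).
    apply: dominatedM (dominated_grad (rate_bounded_cst (u_norm s))) => p.
    by rewrite normr1.
  have e : rsum (fun x => pi x * L (u s) x) = 0.
    transitivity (rsum (fun x => pi x * cst 1 x * L (u s) x)).
      by congr rsum; apply/funext => x; rewrite mulr1.
    rewrite -(flow_sum_generator (rate_bounded_cst (u_norm s)) d).
    have := flow_sum_fst_grad d.
    rewrite (_ : (fun p => _ * _) = fun p : X * X => 0); last first.
      by apply/funext => p; rewrite /grad subrr mul0r.
    rewrite [LHS](_ : _ = 0); first by lra.
    rewrite /flow_sum (@rsum_fset _ _ fset0) ?big_seq_fset0// => p _.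
    by rewrite mulr0.
  rewrite -e.
  apply: (is_derive_rsum s0 (summableRZ (2 * b) summableR_pi_rate) (f' := fun s x
    => pi x * L (u s) x)) => //.
  - move=> r x; rewrite ltr_norml => /andP[rs _]; have r0 : 0 < r by lra.
    have h1 := u_der x r0.
    by apply: is_derive_eq; rewrite /GRing.scale/= mulr0 add0r.
  - move=> r x _; rewrite normrM (gtr0_norm (pi_gt0 x)) mulrCA.
    by apply: ler_wpM2l => //; rewrite ltW// pi_gt0.
have h1 := @le0_derive_homo _ M (cst 0) cM dM (fun _ _ => lexx _) 0 t (lexx _) t0.
have cN : continuous (fun s => - M s) by move=> s; apply: cvgN; exact: cM.
have dN (s : R) : 0 < s -> is_derive s 1 (fun s => - M s) 0.
  by move=> s0; have d := dM s s0; apply: is_derive_eq; rewrite oppr0.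
have h2 := @le0_derive_homo _ _ (cst 0) cN dN (fun _ _ => lexx _) 0 t (lexx _) t0.
by apply/eqP; rewrite -u0_mass -/(M 0) eq_le h1 -lerN2.
Qed.

(** Differences of u_t tend to 0 along paths, and by conservation of mass the pi-average of u_t y -
    u_t x over y is exactly 1 - u_t x. *)
Lemma heat_flow_cvg1 x : u t x @[t --> +oo] --> (1 : R).
Proof.
have h : rsum (fun y => (u t y - u t x) * pi y) @[t --> +oo] --> (0 : R).
  have -> : (0 : R) = rsum (fun y => 0 * pi y).
    rewrite (@rsum_fset _ _ fset0) ?big_seq_fset0// => p _; exact: mul0r.
  apply: (rsum_cvg (summableRZ (2 * b) summableR_pi)).
  - apply: nearW => t y; rewrite normrM (gtr0_norm (pi_gt0 _)).
    apply: ler_wpM2r; first by rewrite ltW// pi_gt0.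
    exact: (grad_bounded (u_norm t) (x, y)).
  - by move=> y; rewrite mul0r normr0 !mulr_ge0// ltW// pi_gt0.
  - by move=> y; apply: cvgM; [exact: path_cvg0|exact: cvg_cst].
rewrite -(subr0 (1 : R)).
have h' : 1 - rsum (fun y => (u t y - u t x) * pi y) @[t --> +oo] --> (1 - 0 : R).
  by apply: cvgB => //; exact: cvg_cst.
apply: cvg_trans h'; apply: near_eq_cvg; near=> t.
have t0 : 0 <= t by near: t; exact/nbhs_pinfty_ge/num_real.
have -> : (fun y => (u t y - u t x) * pi y) = fun y => u t y * pi y - u t x * pi y.
  by apply/funext => y; rewrite mulrBl.
rewrite rsumB//; last by apply: summableRZ; exact: summableR_pi.
rewrite rsumZ; last exact: summableR_pi.
by rewrite rsum_pi mass_along//; lra.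
Unshelve. all: by end_near. Qed.

Lemma entropy_along_cvg0 : entropy_along t @[t --> +oo] --> (0 : R).
Proof.
have -> : (0 : R) = rsum (fun y => 1 * ln 1 * pi y).
  rewrite (@rsum_fset _ _ fset0) ?big_seq_fset0// => p _.
  by rewrite ln1 mulr0 mul0r.
have bc : 0 <= b * c by rewrite mulr_ge0.
apply: (rsum_cvg (summableRZ (b * c) summableR_pi)).
- apply: nearW => s x.
  rewrite !normrM ler_pM ?mulr_ge0//; first by rewrite ler_pM.
  by rewrite ger0_norm// ltW// pi_gt0.
- by move=> x; rewrite ln1 mulr0 mul0r normr0 mulr_ge0// ltW// pi_gt0.
- move=> x; apply: cvgM; last exact: cvg_cst.
  have h := heat_flow_cvg1 x.
  apply: cvgM => //; apply: continuous_cvg => //; exact: continuous_ln.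
Qed.

(* [entropy_along - fisher / (2 kappa)] is nondecreasing and tends to 0. *)
Lemma log_sobolev_along t : 0 <= t ->
  entropy_along t <= (2 * kappa)^-1 * fisher (u t).
Proof.
move=> t0; have k0 : 0 < 2 * kappa by rewrite mulr_gt0.
pose G s := (2 * kappa)^-1 * fisher (u s) - entropy_along s.
have cG : continuous G.
  move=> s; apply: cvgB; last exact: entropy_along_continuous.
  by apply: cvgM; [exact: cvg_cst|exact: fisher_along_continuous].
have dG (s : R) : 0 < s ->
    is_derive s 1 G ((2 * kappa)^-1 * fisher_rate (u s) + fisher (u s)).
  move=> s0; have h1 := fisher_along_derive s0; have h2 := entropy_along_derive s0.
  apply: is_derive_eq; rewrite /GRing.scale/=; by ring.
have G'le (s : R) : 0 < s -> (2 * kappa)^-1 * fisher_rate (u s) + fisher (u s) <= 0.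
  move=> _; have h := fisher_rate_le a_gt0 (u_ge s) (u_le s) CD.
  by rewrite -lerBrDr sub0r ler_pdivrMl//; lra.
(* Dropping the nonnegative Fisher term at time s leaves a bound that tends to 0 with s. *)
have Gle s : t <= s -> - G t <= entropy_along s.
  move=> ts; have h1 : G s <= G t by exact: le0_derive_homo cG dG G'le _ _ t0 ts.
  have h2 : 0 <= (2 * kappa)^-1 * fisher (u s).
    by rewrite mulr_ge0 ?fisher_ge0// invr_ge0 ltW.
  by rewrite lerNl (le_trans _ h1)// /G lerDr.
have : - G t <= 0.
  apply: (cvgr_to_ge entropy_along_cvg0); near=> s; apply: Gle.
  by near: s; exact/nbhs_pinfty_ge/num_real.
by rewrite /G; lra.
Unshelve. all: by end_near. Qed.

Lemma entropy_along_decay t : 0 <= t ->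
  entropy_along t <= expR (- (2 * kappa * t)) * entropy_along 0.
Proof.
move=> t0; have k0 : 0 < 2 * kappa by rewrite mulr_gt0.
have h := decay entropy_along_continuous entropy_along_derive.
have := h _ 0 t (lexx 0) t0; rewrite mulr0 expR0 mul1r => h'.
rewrite expRN mulrC ler_pdivlMr ?expR_gt0// mulrC; apply: h' => s s0.
have := log_sobolev_along (ltW s0).
by rewrite ler_pdivlMl//; lra.
Qed.
End heat_flow.
End reversible_rates.

(** * Measures, integrals and primitives *)
Section esum_integral.
Context {R : realType} {X : countType}.

(** Enumerating X turns the sum into a series over nat, to which the measurability and monotone
    convergence results for series apply. *)
Lemma esum_pickle (a : X -> \bar R) : (forall x, 0 <= a x)%E ->
  (\esum_(x in [set: X]) a x = \sum_(n <oo) oapp a 0 (pickle_inv n))%E.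
Proof.
move=> a0; have o0 n : (0 <= oapp a 0 (pickle_inv n : option X))%E.
  by case: pickle_inv => //=.
rewrite nneseries_esumT//.
transitivity (\esum_(n in @choice.pickle X @` [set: X]) oapp a 0 (pickle_inv n :
  option X))%E.
  rewrite esum_image; first by apply: eq_esum => x _; rewrite pickleK_inv.
  by move=> x y _ _; exact: (pcan_inj choice.pickleK).
rewrite esum_mkcond; apply: eq_esum => n _; case: ifPn => //.
rewrite notin_setE/= => h; case E : pickle_inv => [x|]//=.
by exfalso; apply: h; exists x => //; have := @pickle_invK X n; rewrite E.
Qed.

Context d (T : measurableType d) (mu : {measure set T -> \bar R}).
Variables (D : set T) (mD : measurable D) (f : X -> T -> \bar R).
Hypothesis mf : forall x, measurable_fun D (f x).
Hypothesis f0 : forall x t, (0 <= f x t)%E.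

Let of0 n t : (0 <= oapp (f ^~ t) 0 (pickle_inv n : option X))%E.
Proof. by case: pickle_inv => //=. Qed.

Let omf n : measurable_fun D (fun t => oapp (f ^~ t) 0%E (pickle_inv n : option X)).
Proof. by case: pickle_inv => [x|]//=; exact: measurable_cst. Qed.

Lemma measurable_fun_esum : measurable_fun D (fun t => \esum_(x in [set: X]) f x
  t)%E.
Proof.
under eq_fun do rewrite esum_pickle//.
by apply: ge0_emeasurable_sum.
Qed.

Lemma integral_esum :
  (\int[mu]_(t in D) (\esum_(x in [set: X]) f x t) =
   \esum_(x in [set: X]) \int[mu]_(t in D) f x t)%E.
Proof.
under eq_integral do rewrite esum_pickle//.
rewrite integral_nneseries// esum_pickle => [|x]; last exact: integral_ge0.
apply: eq_eseriesr => n _; case: pickle_inv => [x|]//=; exact: integral0.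
Qed.

End esum_integral.

Section partition_by_countable.
Context {R : realType} {X : countType}.
Context d (T : measurableType d) (mu : {measure set T -> \bar R}).
Variable Z : T -> X.
Hypothesis mZ : forall x, measurable [set t | Z t = x].

Lemma esum_indic (a : X -> \bar R) (x : X) : (forall x, 0 <= a x)%E ->
  (\esum_(y in [set: X]) (if y == x then a y else 0) = a x)%E.
Proof.
move=> a0; rewrite -[RHS](esum_set1 (a0 x)) esum_mkcond.
rewrite [RHS]esum_mkcond; apply: eq_esum => y _; rewrite in_setT.
by case: eqP => [->|/eqP yx]; case: ifPn => //;
  rewrite ?inE ?notin_setE//= => /eqP; rewrite ?eqxx// (negPf yx).
Qed.

(** X carries no sigma-algebra, so f o Z is written as a countable sum over the level sets of Z. *)
Lemma measurable_fun_countable (f : X -> R) : (forall x, 0 <= f x) ->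
  measurable_fun [set: T] (fun t => (f (Z t))%:E).
Proof.
move=> f0.
have -> : (fun t => (f (Z t))%:E) =
    fun t => (\esum_(x in [set: X]) ((f x)%:E * (\1_[set t | Z t = x] t)%:E))%E.
  apply/funext => t; rewrite -(@esum_indic (fun x => (f x)%:E)) => [|x];
    last by rewrite lee_fin.
  apply: eq_esum => x _; rewrite indicE; case: eqP => [->|xZ].
    by rewrite mem_set// mule1.
  by rewrite memNset ?mule0//=; exact: nesym.
apply: measurable_fun_esum => [x|x t].
  by apply: measurable_funeM; apply/measurable_EFinP; exact: measurable_indic.
by rewrite mule_ge0// lee_fin.
Qed.

Lemma integral_partition (D : set T) (g : T -> \bar R) : measurable D ->
  measurable_fun [set: T] g -> (forall t, 0 <= g t)%E ->
  (\int[mu]_(t in D) g t =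
   \esum_(x in [set: X]) \int[mu]_(t in D `&` [set t | Z t = x]) g t)%E.
Proof.
move=> mD mg g0.
transitivity (\int[mu]_(t in D) \esum_(x in [set: X]) (g \_ [set t | Z t = x]) t)%E.
  apply: eq_integral => t _.
  rewrite -[LHS](@esum_indic (cst (g t)) (Z t)); last by move=> x; exact: g0.
  apply: eq_esum => x _; rewrite patchE; case: eqP => [->|xZ].
    by rewrite mem_set.
  by rewrite memNset//=; exact: nesym.
rewrite integral_esum//.
- by apply: eq_esum => x _; rewrite -integral_mkcondr.
- move=> x; apply: measurable_funTS; apply/(measurable_restrictT _ _).1 => //.
  exact: measurable_funTS.
- by move=> x t; rewrite patchE; case: ifP.
Qed.

End partition_by_countable.

(** * Convolution of laws on the line *)

Section sum_of_independent.
Context {R : realType}.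
Local Notation RR := (measurableTypeR R).

Definition add_pair (p : RR * RR) : RR := (p.1 : R) + (p.2 : R).

Lemma measurable_add_pair : measurable_fun [set: RR * RR] add_pair.
Proof. by apply: measurable_funD;
  [exact: measurable_fst|exact: measurable_snd]. Qed.

HB.instance Definition _ := isMeasurableFun.Build _ _ _ _ add_pair
  measurable_add_pair.

Definition convolution (P Q : probability RR R) : probability RR R :=
  distribution (P \x Q)%E add_pair.

End sum_of_independent.

(** * Primitives of locally bounded functions *)

Section primitive.
Context {R : realType}.
Local Notation mu := (@lebesgue_measure R).
Implicit Types G : R -> R.

Definition locally_bounded G := forall T : R, exists C : R,
  forall r, 0 <= r -> r <= T -> `|G r| <= C.

Lemma bounded_integrable G (a b C : R) : measurable_fun `[a, b] G ->
  (forall r, a <= r -> r <= b -> `|G r| <= C) -> mu.-integrable `[a, b] (EFin \o G).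
Proof.
move=> mG GC; apply: measurable_bounded_integrable => //.
  by rewrite /= lebesgue_measure_itv/=; case: ifP => _; rewrite ltry.
rewrite /bounded_near; near=> M => x /=; rewrite in_itv/= => /andP[ax xb].
by apply: le_trans (GC _ ax xb) _; near: M; exact/nbhs_pinfty_ge/num_real.
Unshelve. all: by end_near. Qed.

Lemma continuous_locally_bounded (G : R -> R) : continuous G -> locally_bounded G.
Proof.
move=> cG T; have [T0|T0] := ltP T 0.
  by exists 0 => r r0 rT; have := le_trans r0 rT; rewrite leNgt T0.
have cG' : {within `[0, T], continuous (fun r => `|G r|)}.
  by apply: continuous_subspaceT => r; apply: cvg_norm; exact: cG.
have [c _ h] := EVT_max T0 cG'.
by exists `|G c| => r r0 rT; apply: h; rewrite in_itv/= r0.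
Qed.

Lemma continuous_measurable_itv (G : R -> R) (D : set R) : continuous G ->
  measurable_fun D G.
Proof. by move=> /continuous_measurable_fun/measurable_funTS. Qed.

Lemma continuous_exp_rate (c : R) : continuous (fun r : R => expR (c * r)).
Proof.
move=> r; apply: (@continuous_comp _ _ _ (fun r => c * r) (@expR R)).
  by apply: cvgM; [exact: cvg_cst|exact: cvg_id].
exact: continuous_expR.
Qed.

Lemma continuous_integrable (H : R -> R) (t : R) : continuous H ->
  lebesgue_measure.-integrable `[0, t] (EFin \o H).
Proof.
move=> cH; have [C HC] := continuous_locally_bounded cH t.
by apply: (@bounded_integrable _ _ _ C) => //; exact: continuous_measurable_itv.
Qed.

Definition primitive G (t : R) := \int[mu]_(r in `[0, t]) G r.

Lemma primitive_lt0 G (t : R) : t < 0 -> primitive G t = 0.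
Proof. by move=> t0; rewrite /primitive set_itv_ge ?Rintegral_set0// bnd_simp
  -ltNge. Qed.

Lemma primitive0 G : primitive G 0 = 0.
Proof. by rewrite /primitive set_itv1 Rintegral_set1. Qed.

Variable G : R -> R.
Hypothesis mG : forall T : R, measurable_fun `[0, T] G.
Hypothesis bG : locally_bounded G.

(** Boundedness on [0, T] suffices for all times up to T, since the primitive is 0 on negative
    times. Continuity of the primitive thus holds on the whole line before G is known to be
    continuous. *)
Lemma primitive_lipschitz (T : R) : exists2 C : R, 0 <= C & forall s t, s <= t -> t
  <= T ->
  `|primitive G t - primitive G s| <= C * (t - s).
Proof.
have [C GC] := bG T; exists `|C| => // s t st tT.
have [t0|t0] := ltP t 0.
  rewrite !primitive_lt0// ?(le_lt_trans st)// subrr normr0 mulr_ge0// subr_ge0//.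
have H (r : R) : 0 <= r -> r <= t ->
  `|primitive G t - primitive G r| <= `|C| * (t - r).
  move=> r0 rt.
  have iG : mu.-integrable `[0, t] (EFin \o G).
    by apply: (@bounded_integrable _ _ _ C) => // u u0 ut; apply: GC => //;
      exact: le_trans tT.
  have iG' : mu.-integrable `]r, t] (EFin \o G).
    apply: integrableS iG => // u /=; rewrite !in_itv/= => /andP[ru ->].
    by rewrite andbT (le_trans r0)// ltW.
  rewrite /primitive Rintegral_itvB;
    [|exact: iG|by rewrite bnd_simp|by rewrite bnd_simp].
  apply: (le_trans (le_normr_Rintegral _ _)) => //.
  have m' : fine (mu `]r, t]) = t - r.
    rewrite lebesgue_measure_itv/= lte_fin.
    by move: rt; rewrite le_eqVlt => /predU1P[->|->//]; rewrite ltxx subrr.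
  rewrite -m' -Rintegral_cst//; apply: le_Rintegral => //.
  - exact: (integrable_norm iG').
  - have iC : mu.-integrable `[r, t] (EFin \o cst `|C|).
      by apply: (@bounded_integrable _ _ _ `|C|) => // *; rewrite normr_id.
    by apply: integrableS iC => // u /=; rewrite !in_itv/= => /andP[/ltW -> ->].
  - move=> u /=; rewrite in_itv/= => /andP[ru ut].
    have := GC u (le_trans r0 (ltW ru)) (le_trans ut tT).
    by move=> /le_trans; apply; exact: ler_norm.
have [s0|s0] := ltP s 0; last exact: H.
have := H 0 (lexx 0) t0; rewrite primitive0 (primitive_lt0 G s0) => /le_trans;
  apply.
by rewrite ler_wpM2l// subr0 lerDl oppr_ge0 ltW.
Qed.

Lemma primitive_continuous : continuous (primitive G).
Proof.
move=> t; have [C C0 L] := primitive_lipschitz (t + 1).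
have C1 : 0 < C + 1 by rewrite ltr_wpDl.
apply/cvgrPdist_le => e e0; near=> s.
have hs : `|t - s| < Num.min 1 (e / (C + 1)).
  near: s; exists (Num.min 1 (e / (C + 1))) => //=.
  by rewrite lt_min ltr01 divr_gt0.
move: hs; rewrite lt_min => /andP[h1 h2].
have h3 : C * `|t - s| <= e.
  rewrite ltr_pdivlMr// in h2.
  by apply: le_trans (ltW h2); rewrite mulrC ler_wpM2l// lerDl.
have [st|/ltW ts] := leP s t.
  have := L _ _ st; rewrite -[X in C * X](ger0_norm (_ : 0 <= t - s)) ?subr_ge0//.
  by move=> H; apply: le_trans (H _) h3; rewrite lerDl.
have := L _ _ ts; rewrite -[X in C * X](ger0_norm (_ : 0 <= s - t)) ?subr_ge0//.
rewrite distrC (distrC s) => H; apply: le_trans (H _) h3.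
by move: h1; rewrite ltr_norml => /andP[? ?]; lra.
Unshelve. all: by end_near. Qed.

Lemma primitive_derive (t : R) : 0 < t -> {for t, continuous G} ->
  is_derive t 1 (primitive G) (G t).
Proof.
move=> t0 cG; have [C GC] := bG (t + 1).
have iG : mu.-integrable `[0, t + 1] (EFin \o G).
  exact: (@bounded_integrable _ _ _ C).
have tt : t < t + 1 by rewrite ltrDl.
have [|h1 h2] := @continuous_FTC1 R G (BLeft 0) t (t + 1) tt iG _ cG.
  by rewrite /= lte_fin.
apply: DeriveDef; first exact: h1.
by rewrite -derive1E; exact: h2.
Qed.

End primitive.

(** * Holding times and path expansion *)
Section hold_law.
Context {R : realType} {X : Type}.
Local Notation RR := (measurableTypeR R).
Variable q : X -> R.
Hypothesis q_gt0 : forall x, 0 < q x.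

Definition hold (x : X) : probability RR R :=
  exponential_distribution_exponential_prob__canonical__probability_measure_Probability (q_gt0 x).

Lemma holdE x B : hold x B = exponential_prob (q x) B.
Proof. by []. Qed.

(** The law of the total time spent in the successive states of l, with independent holding
    times. *)
Fixpoint hold_law (l : seq X) : probability RR R :=
  if l is x :: l' then convolution (hold x) (hold_law l') else \d_(0 : RR).

Lemma hold_law_cons_le x l (t : R) :
  (hold_law (x :: l) [set s | (s <= t)%R] =
   \int[lebesgue_measure]_s
     ((exponential_pdf (q x) s)%:E * hold_law l [set r | (r <= t - s)%R]))%E.
Proof.
pose A := @add_pair R @^-1` [set s | s <= t].
have mt (c : R) : measurable ([set s : RR | (s : R) <= c]).
  by have := @measurable_itv R `]-oo, c]; rewrite set_itvNyc.
have mA : measurable A.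
  by rewrite -[A]setTI; apply: measurable_add_pair.
(* The product measure in the other order of integration exposes the exponential density; Tonelli
   then puts the first holding time outside. *)
transitivity ((hold x \x^ hold_law l)%E A).
  apply: product_measure_unique => // B C mB mC.
  exact: product_measure2E.
rewrite /product_measure2.
pose g (p : RR * RR) := ((exponential_pdf (q x) p.2)%:E * (\1_A (p.2, p.1))%:E)%E.
have mg : measurable_fun setT g.
  apply: emeasurable_funM.
    apply/measurable_EFinP; apply: measurableT_comp; last exact: measurable_snd.
    exact: measurable_exponential_pdf.
  apply/measurable_EFinP; apply: measurableT_comp; first exact: measurable_indic.
  by apply/measurable_fun_pairP; split;
    [exact: measurable_snd|exact: measurable_fst].
have g0 p : (0 <= g p)%E.
  by rewrite mule_ge0// lee_fin exponential_pdf_ge0// ltW.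
transitivity (\int[hold_law l]_b \int[lebesgue_measure]_a g (b, a))%E.
  apply: eq_integral => b _ /=.
  rewrite /exponential_prob integral_mkcond; apply: eq_integral => a _.
  rewrite /g /= patchE indicE /ysection/=.
  case: ifPn; rewrite ?inE ?notin_setE/= => h.
    by rewrite h mule1.
  by rewrite memNset ?mule0//; move=> /mem_set.
rewrite fubini_tonelli//; apply: eq_integral => a _.
transitivity (\int[hold_law l]_b ((exponential_pdf (q x) a)%:E *
    (\1_[set r : RR | (r <= t - a)%R] b)%:E))%E.
  apply: eq_integral => b _; rewrite /g/= !indicE; congr (_ * (_ : bool)%:R%:E)%E.
  by apply/idP/idP; rewrite !inE/= /A/= /add_pair/=; lra.
rewrite ge0_integralZl//.
- by rewrite integral_indic// setIT.
- by apply/measurable_EFinP; exact: measurable_indic.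
- by rewrite lee_fin exponential_pdf_ge0// ltW.
Qed.

(* The distribution function of [hold_law l], on [t >= 0] only: for t < 0 the value
   at [::] is 1. *)
Fixpoint hold_cdf (l : seq X) (t : R) : R :=
  if l is x :: l' then
    expR (- (q x * t)) * primitive (fun r => q x * expR (q x * r) * hold_cdf l' r) t
  else 1.

Lemma hold_cdf_continuous l : continuous (hold_cdf l).
Proof.
elim: l => [|x l ih] /=; first by move=> t; exact: cvg_cst.
have cG : continuous (fun r => q x * expR (q x * r) * hold_cdf l r).
  move=> r; apply: cvgM; last exact: ih.
  by apply: cvgM; [exact: cvg_cst|exact: continuous_exp_rate].
have cE' : continuous (fun t : R => expR (- (q x * t))).
  have -> : (fun t => expR (- (q x * t))) = fun t => expR (- q x * t).
    by apply/funext => r; rewrite mulNr.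
  exact: continuous_exp_rate.
have cP : continuous (primitive (fun r => q x * expR (q x * r) * hold_cdf l r)).
  apply: primitive_continuous; last exact: continuous_locally_bounded.
  by move=> T; exact: continuous_measurable_itv.
by move=> t; apply: cvgM; [exact: cE'|exact: cP].
Qed.

Lemma hold_law_lt0 l (t : R) : t < 0 -> hold_law l [set s | s <= t] = 0%E.
Proof.
elim: l t => [|x l ih] t t0.
  by rewrite /= diracE memNset//=; apply/negP; rewrite -ltNge.
rewrite hold_law_cons_le integral0_eq// => s _.
have [s0|s0] := ltP s 0; first by rewrite lt0_exponential_pdf// mul0e.
by rewrite ih ?mule0//; lra.
Qed.

(** Substituting r = t - s in the convolution and splitting exp (- q (t - r)) as exp (- q t) exp (q
    r) leaves t only in a factor and in the upper limit, which is the recursion of [hold_cdf]. *)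
Lemma hold_lawE l (t : R) : 0 <= t ->
  hold_law l [set s | s <= t] = (hold_cdf l t)%:E.
Proof.
elim: l t => [|x l ih] t t0.
  by rewrite /= diracE mem_set.
rewrite hold_law_cons_le.
pose G r := q x * expR (- (q x * t)) * expR (q x * r) * hold_cdf l r.
have cG : continuous G.
  move=> r; apply: cvgM; last exact: hold_cdf_continuous.
  by apply: cvgM; [exact: cvg_cst|exact: continuous_exp_rate].
transitivity (\int[lebesgue_measure]_(s in `[0%R, t]) (G (t - s))%:E)%E.
  rewrite [RHS]integral_mkcond; apply: eq_integral => s _; rewrite patchE.
  (* Outside [0, t] the integrand vanishes: the density is 0 for s < 0, and the remaining time t - s
     is negative for s > t. *)
  case: ifPn; rewrite ?inE ?notin_setE/= in_itv/=.
    move=> /andP[s0 st]; rewrite exponential_pdfE// ih ?subr_ge0//.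
    rewrite -EFinM; congr EFin; rewrite /G -!mulrA; congr (_ * _).
    by rewrite [RHS]mulrA -expRD; congr (expR _ * _); ring.
  move=> /negP; rewrite negb_and -!ltNge => /orP[s0|st].
    by rewrite lt0_exponential_pdf// mul0e.
  by rewrite hold_law_lt0 ?mule0//; lra.
have Fd : (fun s : R => t - s)^`()%classic = cst (-1).
  by apply/funext => r; rewrite derive1E derive_val add0r mul1r.
have cF : continuous (fun s : R => t - s).
  by move=> s; apply: cvgB; [exact: cvg_cst|exact: cvg_id].
transitivity (\int[lebesgue_measure]_(s in `[0%R, t])
    (((G \o (fun s => t - s)) * - (fun s : R => t - s)^`()%classic) s)%:E)%E.
  by apply: eq_integral => s _; rewrite Fd; congr EFin;
    rewrite mulrfctE/= opprK mulr1.
rewrite -(@integration_by_substitution_decreasing _ (fun s => t - s) G 0 t)//;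
  last first.
- exact: continuous_subspaceT.
- split => //.
  + by apply: cvg_at_right_filter; exact: cF.
  + by apply: cvg_at_left_filter; exact: cF.
- by rewrite Fd; exact: is_cvg_cst.
- by rewrite Fd; exact: is_cvg_cst.
- by rewrite Fd => s _; exact: cvg_cst.
- by move=> a b _ _; rewrite ltrD2l ltrN2.
rewrite subrr subr0 /= /primitive.
rewrite -[LHS]fineK; last exact: integrable_fin_num (continuous_integrable t cG).
congr EFin; rewrite -RintegralZl//; last first.
  apply: continuous_integrable => r; apply: cvgM; last exact: hold_cdf_continuous.
  by apply: cvgM; [exact: cvg_cst|exact: continuous_exp_rate].
by congr fine; apply: eq_integral => r _; rewrite /G; congr EFin; ring.
Qed.

End hold_law.

Section occupation.
Context {R : realType} {X : Type}.
Variable q : X -> R.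
Hypothesis q_gt0 : forall x, 0 < q x.
Local Notation cdf := (hold_cdf q).

(* The probability, given that the jump chain follows x :: s, of being in the last
   state of that path at time t. *)
Definition occupation (x : X) (s : seq X) (t : R) : R :=
  cdf (belast x s) t - cdf (x :: s) t.

Lemma occupation_continuous x s : continuous (occupation x s).
Proof. by move=> t; apply: cvgB; exact: hold_cdf_continuous. Qed.

Lemma occupation_nil x (t : R) : 0 <= t -> occupation x [::] t = expR (- (q x * t)).
Proof.
rewrite le_eqVlt => /predU1P[<-|t0].
  by rewrite /occupation/= primitive0 mulr0 subr0 mulr0 oppr0 expR0.
rewrite /occupation /= /primitive /Rintegral.
under eq_integral do rewrite mulr1.
have cE : continuous (fun r : R => expR (q x * r)) := @continuous_exp_rate _ (q x).
rewrite (@continuous_FTC2 _ _ (fun r => expR (q x * r)) 0 t)//.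
- by rewrite /= mulr0 expR0 mulrBr mulr1 -expRD addNr expR0; ring.
- by apply: continuous_subspaceT => r; apply: cvgM;
    [exact: cvg_cst|exact: continuous_exp_rate].
- split.
  + by move=> r _.
  + by apply: cvg_at_right_filter; exact: continuous_exp_rate.
  + by apply: cvg_at_left_filter; exact: continuous_exp_rate.
- move=> r _; rewrite derive1E derive_val /GRing.scale/=; ring.
Qed.

(** Both distribution functions in [occupation] begin with the holding time at x, so the same
    integral operator factors out of their difference. *)
Lemma occupation_cons x y s (t : R) :
  occupation x (y :: s) t =
  expR (- (q x * t)) * primitive (fun r => q x * expR (q x * r) * occupation y s r)
    t.
Proof.
pose G l r := q x * expR (q x * r) * cdf l r.
transitivity (expR (- (q x * t)) * primitive (G (belast y s)) t -
  expR (- (q x * t)) * primitive (G (y :: s)) t) => //.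
have cH l : continuous (G l).
  move=> r; apply: cvgM; last exact: hold_cdf_continuous.
  by apply: cvgM; [exact: cvg_cst|exact: continuous_exp_rate].
have iH l := continuous_integrable t (cH l).
rewrite -mulrBr -RintegralB; [|by []|exact: iH|exact: iH].
by congr (_ * _); apply: eq_Rintegral => r _; rewrite /G mulrBr.
Qed.

(** Nonnegativity is read off the recursion, which avoids comparing two distribution functions. *)
Lemma occupation_ge0 x s (t : R) : 0 <= t -> 0 <= occupation x s t.
Proof.
elim: s x t => [|y s ih] x t t0; first by rewrite occupation_nil// expR_ge0.
rewrite occupation_cons mulr_ge0 ?expR_ge0// Rintegral_ge0// => r /=.
rewrite in_itv/= => /andP[r0 _].
by rewrite mulr_ge0 ?ih// mulr_ge0 ?expR_ge0// ltW.
Qed.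

End occupation.

(** * Joint law of a path and of its jump times *)

Section joint_law.
Context {R : realType} {X : countType} (k : X -> X -> R).
Context (d : measure_display) (Omega : measurableType d).
Variables (Pr : X -> probability Omega R).
Variables (Y : nat -> Omega -> X) (S : nat -> Omega -> R).
Hypothesis chainP : is_markov_chain k Pr Y S.
Local Notation q := (exit_rate k).
Hypothesis q_gt0 : forall x, 0 < q x.
Local Notation RR := (measurableTypeR R).

Definition path_weight (x : X) (z : nat -> X) (n : nat) : R :=
  (z 0 == x)%:R * \prod_(i < n) jump_matrix k (z i) (z i.+1).

Definition path_event (z : nat -> X) (n : nat) : set Omega :=
  [set w | forall i, (i <= n)%N -> Y i w = z i].

Lemma measurable_path_event z n : measurable (path_event z n).
Proof.
have [mY _ _ _] := chainP.
rewrite (_ : path_event z n = \bigcap_(i in `I_n.+1) [set w | Y i w = z i]).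
  by apply: bigcap_measurableType => i _; exact: mY.
by apply/seteqP; split => w h i; exact: h.
Qed.

Lemma measurable_time (i l : nat) :
  measurable_fun [set: Omega] (fun w => \sum_(i <= j < l) S j w : RR).
Proof.
have [_ mS _ _] := chainP.
by apply: measurable_sum => j; exact: mS.
Qed.

(* The chain axiom only gives boxes for the holding times. By induction on l, one
   more coordinate is replaced by its sum with the following ones: both sides are
   measures on pairs that agree on rectangles. *)
Lemma joint_law (x : X) (z : nat -> X) (n l i : nat) (A : nat -> set R)
    (B : set R) :
  (i + l <= n.+1)%N -> (forall j, measurable (A j)) -> measurable B ->
  Pr x (path_event z n `&` [set w | forall j, (j < i)%N -> A j (S j w)] `&`
        [set w | B (\sum_(i <= j < i + l) S j w)]) =
  ((path_weight x z n * \prod_(j < i) fine (exponential_prob (q (z j)) (A j)))%:E *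
   hold_law q_gt0 [seq z j | j <- iota i l] B)%E.
Proof.
have [mY mS S0 law] := chainP.
elim: l i A B => [|l ih] i A B il mA mB.
  rewrite addn0 /= in il *.
  have E : [set w | B (\sum_(i <= j < i) S j w)] = [set w | B 0].
    by apply/seteqP; split => w /=; rewrite big_geq.
  rewrite E diracE; have [B0|B0] := pselect (B 0); last first.
    rewrite memNset// mule0 (_ : [set w | B 0] = set0) ?setI0 ?measure0//.
    by apply/seteqP; split => w.
  rewrite mem_set// mule1 (_ : [set w | B 0] = setT) ?setIT; last first.
    by apply/seteqP; split.
  (* The coordinates from i on are left free and contribute factors equal to 1. *)
  pose A' j := if (j < i)%N then A j else [set: R].
  have mA' j : measurable (A' j) by rewrite /A'; case: ifP.
  have := law x n z A' mA'; rewrite -/(path_weight x z n) => {law} law.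
  rewrite [X in Pr x X](_ : _ = [set w | forall i, (i <= n)%N ->
    Y i w = z i /\ A' i (S i w)]).
    rewrite law; congr (_ * _)%:E.
    rewrite -(big_mkord xpredT (fun j => fine (exponential_prob (- k (z j) (z j))
      (A' j)))).
    rewrite (big_cat_nat _ il)//= [X in _ * X]big1_seq ?mulr1.
      rewrite big_mkord; apply: eq_bigr => j _.
      by rewrite /A' ltn_ord.
    move=> j; rewrite mem_index_iota => /andP[_ /andP[ij _]].
    by rewrite /A' ltnNge ij/= -(holdE q_gt0) probability_setT.
  apply/seteqP; split => w /=.
    by move=> [h1 h2] j jn; split; [exact: h1|rewrite /A'; case: ifPn => // /h2].
  move=> h; split => j jn; first by have [] := h j jn.
  have [] := h j; first by rewrite -ltnS (leq_trans jn).
  by rewrite /A' jn.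
have il' : (i.+1 + l <= n.+1)%N by rewrite addSnnS.
have mE := measurable_path_event z n.
have mH : measurable [set w | forall j, (j < i)%N -> A j (S j w)].
  rewrite (_ : [set w | _] = \bigcap_(j in `I_i) (S j @^-1` A j)).
    apply: bigcap_measurableType => j _; rewrite -[X in measurable X]setTI.
    exact: mS.
  by apply/seteqP; split => w h j; exact: h.
pose D := path_event z n `&` [set w | forall j, (j < i)%N -> A j (S j w)].
have mD : measurable D by exact: measurableI.
pose h (w : Omega) : RR * RR := (S i w, \sum_(i.+1 <= j < i.+1 + l) S j w).
have mh : measurable_fun [set: Omega] h.
  apply/measurable_fun_pairP; split; first exact: mS.
  exact: measurable_time.
set c := path_weight x z n * _.
(* The induction hypothesis at i + 1, read as the law of the pair (S i, sum of the next l times) on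
   rectangles: A0 constrains coordinate i. *)
have IH (A0 B0 : set R) : measurable A0 -> measurable B0 ->
    Pr x (D `&` [set w | A0 (h w).1 /\ B0 (h w).2]) =
    (c%:E * (hold q_gt0 (z i) A0 * hold_law q_gt0 [seq z j | j <- iota i.+1 l]
      B0))%E.
  move=> mA0 mB0; pose A' j := if j == i then A0 else A j.
  have mA' j : measurable (A' j) by rewrite /A'; case: ifP.
  have := ih i.+1 A' B0 il' mA' mB0.
  have Ai : A' i = A0 by rewrite /A' eqxx.
  have eP : \prod_(j < i) fine (exponential_prob (q (z j)) (A' j)) =
      \prod_(j < i) fine (exponential_prob (q (z j)) (A j)).
    by apply: eq_bigr => j _; rewrite /A' ltn_eqF.
  rewrite big_ord_recr/= Ai mulrA eP -/c => e.
  rewrite [X in Pr x X](_ : _ = path_event z n `&`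
    [set w | forall j : nat, (j < i.+1)%N -> A' j (S j w)] `&`
    [set w | B0 (\sum_(i.+1 <= j < i.+1 + l) S j w)]).
    rewrite {}e EFinM -(holdE q_gt0) fineK ?muleA//.
    exact: fin_num_measure.
  apply/seteqP; split => w /=.
    move=> [[h1 h2] [h3 h4]]; split; last exact: h4.
    split; first exact: h1.
    move=> j; rewrite ltnS leq_eqVlt /A' => /orP[/eqP ->|ji]; first by rewrite eqxx.
    by rewrite ltn_eqF//; exact: h2.
  move=> [[h1 h2] h4]; split; last first.
    by split; last exact: h4; have := h2 i (ltnSn i); rewrite /A' eqxx.
  split; first exact: h1.
  by move=> j ji; have := h2 j (ltnW ji); rewrite /A' ltn_eqF.
have PD : Pr x D = c%:E.
  have := IH setT setT measurableT measurableT;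
    rewrite !probability_setT !mule1 => <-.
  by congr (Pr x _); rewrite -[LHS]setIT; congr (_ `&` _); apply/seteqP; split.
have c0 : 0 <= c by rewrite -lee_fin -PD.
have -> : [set w | B (\sum_(i <= j < i + l.+1) S j w)] =
  h @^-1` (@add_pair R @^-1` B).
  have sumE w : \sum_(i <= j < i + l.+1) S j w =
      S i w + \sum_(i.+1 <= j < i.+1 + l) S j w.
    by rewrite big_ltn ?addSnnS// addnS ltnS leq_addr.
  by apply/seteqP; split => w /=; rewrite sumE.
have mX : measurable (@add_pair R @^-1` B).
  by rewrite -[X in measurable X]setTI; exact: measurable_add_pair.
have mhX : measurable (h @^-1` (@add_pair R @^-1` B)).
  by rewrite -[X in measurable X]setTI; exact: mh.
(* c is the mass of D. If it is 0 both sides vanish; otherwise dividing by c makes uniqueness of the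
   product measure applicable. *)
have [c00|cn0] := eqVneq c 0.
  rewrite c00 mul0e; apply/eqP; rewrite eq_le measure_ge0 andbT.
  rewrite -[leRHS]/(0%:E) -c00 -PD; apply: le_measure; rewrite ?inE//.
  exact: measurableI.
pose mu : {measure set (RR * RR) -> \bar R} :=
  measure_function_pushforward__canonical__measure_function_Measure (mrestr (Pr x)
    mD) mh.
have ci : 0 <= c^-1 by rewrite invr_ge0.
pose mu' : {measure set (RR * RR) -> \bar R} := mscale (NngNum ci) mu.
have E := @product_measure_unique _ _ RR RR R (hold q_gt0 (z i))
  (hold_law q_gt0 [seq z j | j <- iota i.+1 l]) mu'.
rewrite (_ : hold_law q_gt0 [seq z j | j <- iota i l.+1] B =
  (hold q_gt0 (z i) \x hold_law q_gt0 [seq z j | j <- iota i.+1 l])%E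
    (@add_pair R @^-1` B))//.
rewrite E//.
  rewrite /mu' /= /mscale/= /pushforward /mrestr muleA -EFinM divff// mul1e.
  by rewrite setIC.
move=> A0 B0 mA0 mB0.
rewrite /mu' /= /mscale/= /pushforward /mrestr setIC -[X in Pr x X]/(D `&` _).
rewrite [X in Pr x X](_ : _ = D `&` [set w | A0 (h w).1 /\ B0 (h w).2])// IH//.
by rewrite muleA -EFinM mulVf// mul1e.
Qed.

End joint_law.

(** * Expansion of the expectation over the paths of the jump chain *)

Section path_expansion.
Context {R : realType} {X : countType} (k : X -> X -> R).
Context (d : measure_display) (Omega : measurableType d).
Variables (Pr : X -> probability Omega R).
Variables (Y : nat -> Omega -> X) (S : nat -> Omega -> R).
Hypothesis chainP : is_markov_chain k Pr Y S.
Hypothesis k_ge0 : forall x y, x != y -> 0 <= k x y.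
Local Notation q := (exit_rate k).
Hypothesis q_gt0 : forall x, 0 < q x.
Variable f : X -> R.
Hypothesis f_ge0 : forall x, 0 <= f x.
Local Notation RR := (measurableTypeR R).
Local Notation mu := (@lebesgue_measure R).
Local Notation J := (jump_matrix k).

Lemma jump_matrix_ge0 x y : 0 <= J x y.
Proof.
rewrite /jump_matrix; case: eqP => // /eqP xy.
by rewrite divr_ge0 ?k_ge0// ltW// q_gt0.
Qed.

Definition path_state (x : X) (s : seq X) (i : nat) : X := nth x (x :: s) i.

Definition seq_event (x : X) (s : seq X) : set Omega :=
  path_event Y (path_state x s) (size s).

Fixpoint seq_weight (x : X) (s : seq X) : R :=
  if s is y :: s' then J x y * seq_weight y s' else 1.

Lemma seq_weight_ge0 x s : 0 <= seq_weight x s.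
Proof. by elim: s x => //= y s ih x; rewrite mulr_ge0// jump_matrix_ge0. Qed.

Lemma path_weight_seq x s : path_weight k x (path_state x s) (size s) =
  seq_weight x s.
Proof.
rewrite /path_weight /path_state/= eqxx mul1r.
elim: s x => [|y s ih] x /=; first by rewrite big_ord0.
rewrite big_ord_recl/= -ih; congr (_ * _); apply: eq_bigr => i _ /=.
by congr (J _ _); apply: set_nth_default; rewrite /= add0n // ltnS ltnW.
Qed.

Definition cell (n : nat) (t : R) : set Omega :=
  [set w | jump_time S n w <= t < jump_time S n.+1 w].

Lemma measurable_jump_time_le n (t : R) : measurable [set w | jump_time S n w <= t].
Proof.
have [_ mS _ _] := chainP.
have mJ : measurable_fun [set: Omega] (jump_time S n).
  by rewrite /jump_time; apply: measurable_sum => j; exact: mS.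
rewrite (_ : [set w | _] = jump_time S n @^-1` `]-oo, t]%classic).
  by rewrite -[X in measurable X]setTI; exact: mJ.
by apply/seteqP; split => w /=; rewrite in_itv.
Qed.

Lemma cellE n (t : R) :
  cell n t = [set w | jump_time S n w <= t] `\` [set w | jump_time S n.+1 w <= t].
Proof.
apply/seteqP; split => w /=; first by move=> /andP[? ?]; split => //; apply/negP;
  rewrite -ltNge.
by move=> [h1 /negP h2]; apply/andP; split => //; rewrite ltNge.
Qed.

Lemma measurable_cell n (t : R) : measurable (cell n t).
Proof. by rewrite cellE; apply: measurableD; exact: measurable_jump_time_le. Qed.

Lemma seq_event_jump_time x s l (t : R) : (l <= (size s).+1)%N -> 0 <= t ->
  Pr x (seq_event x s `&` [set w | jump_time S l w <= t]) =
  (seq_weight x s * hold_cdf q (take l (x :: s)) t)%:E.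
Proof.
move=> ls t0.
have mt : measurable ([set u : R | u <= t]).
  by have := @measurable_itv R `]-oo, t]; rewrite set_itvNyc.
have := @joint_law R X k d Omega Pr Y S chainP q_gt0 x (path_state x s) (size s) l 0
  (fun=> setT) [set u : R | u <= t] ls (fun=> measurableT) mt.
rewrite big_ord0 mulr1 path_weight_seq hold_lawE// -EFinM.
rewrite map_nth_iota0// => <-; congr (Pr x _); apply/seteqP; split => w /=.
  by move=> [h1 h2]; split; [split|rewrite add0n big_mkord].
by move=> [[h1 _]]; rewrite add0n big_mkord.
Qed.

Lemma seq_event_cell x s (t : R) : 0 <= t ->
  Pr x (seq_event x s `&` cell (size s) t) =
    (seq_weight x s * occupation q x s t)%:E.
Proof.
move=> t0; have [_ mS S0 _] := chainP.
have mE : measurable (seq_event x s) by exact: measurable_path_event chainP _ _.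
have mJ l : measurable (seq_event x s `&` [set w | jump_time S l w <= t]).
  by apply: measurableI => //; exact: measurable_jump_time_le.
rewrite cellE setIDA.
rewrite (_ : _ `\` _ = (seq_event x s `&` [set w | jump_time S (size s) w <= t]) `\`
  (seq_event x s `&` [set w | jump_time S (size s).+1 w <= t])); last first.
  apply/seteqP; split => w /= [[h1 h2] h3]; split => //; first by move=> [].
  by move=> h4; apply: h3.
rewrite measureD//; last by rewrite ltey_eq fin_num_measure.
rewrite [X in (_ - Pr x X)%E](_ : _ =
  seq_event x s `&` [set w | jump_time S (size s).+1 w <= t]).
  transitivity ((seq_weight x s * hold_cdf q (take (size s) (x :: s)) t)%:E -
      (seq_weight x s * hold_cdf q (take (size s).+1 (x :: s)) t)%:E)%E.
    by congr (_ - _)%E; exact: seq_event_jump_time.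
  rewrite -EFinB -mulrBr /occupation.
  have -> : take (size s) (x :: s) = belast x s.
    by rewrite lastI -cats1 take_size_cat// size_belast.
  by rewrite (_ : take _ _ = x :: s)// take_oversize.
apply/seteqP; split => w /=; first by move=> [].
(* Holding times are positive, so the next jump time being at most t implies the same for the
   present one. *)
move=> [h1 h2]; split => //; split => //; apply: le_trans h2.
by rewrite /jump_time big_ord_recr/= lerDl ltW.
Qed.

Definition cell_value (t : R) (n : nat) (w : Omega) : \bar R :=
  (f (Y n w) * \1_(cell n t) w)%:E.

Lemma cell_value_ge0 t n w : (0 <= cell_value t n w)%E.
Proof. by rewrite lee_fin mulr_ge0. Qed.

Lemma measurable_cell_value t n : measurable_fun [set: Omega] (cell_value t n).
Proof.
have [mY _ _ _] := chainP.
rewrite /cell_value; under eq_fun do rewrite EFinM; apply: emeasurable_funM.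
  exact: measurable_fun_countable.
by apply/measurable_EFinP; apply: measurable_indic; exact: measurable_cell.
Qed.

(* [E_x] of f at time t on the event that n more jumps after the path x :: s have
   occurred by then. [Num.max t 0] makes this constant on negative times, hence
   continuous on the whole line. *)
Fixpoint path_sum (n : nat) (x : X) (s : seq X) (t : R) : \bar R :=
  if n is n'.+1 then (\esum_(y in [set: X]) path_sum n' x (rcons s y) t)%E
  else (f (last x s) * (seq_weight x s * occupation q x s (Num.max t 0)))%:E.

Lemma path_sum_ge0 n x s t : (0 <= path_sum n x s t)%E.
Proof.
case: n => [|n] /=; last first.
  by apply: esum_ge0 => y _; elim: n s y => [|n ih] s y /=;
    [|apply: esum_ge0 => z _; exact: ih];
    rewrite lee_fin !mulr_ge0 ?seq_weight_ge0 ?occupation_ge0// le_max lexx orbT.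
by rewrite lee_fin !mulr_ge0 ?seq_weight_ge0 ?occupation_ge0// le_max lexx orbT.
Qed.

(** Each step of the induction splits the event according to the value of the next state, which
    appends one point to the path. *)
Lemma integral_seq_event n x s (t : R) : 0 <= t ->
  (\int[Pr x]_(w in seq_event x s) cell_value t (size s + n) w =
    path_sum n x s t)%E.
Proof.
move=> t0; have [mY _ _ _] := chainP.
have mE s' : measurable (seq_event x s') by exact: measurable_path_event chainP _ _.
elim: n s => [|n ih] s /=.
  rewrite addn0.
  transitivity (\int[Pr x]_(w in seq_event x s) ((f (last x s))%:E * (\1_(cell
    (size s) t) w)%:E))%E.
    apply: eq_integral => w; rewrite inE => Ew; rewrite /cell_value (Ew (size s))//.
    by rewrite /path_state -last_nth EFinM.
  rewrite ge0_integralZl//.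
  - rewrite integral_indic//; last exact: measurable_cell.
    transitivity ((f (last x s))%:E * (seq_weight x s * occupation q x s t)%:E)%E.
      by congr (_ * _)%E; rewrite setIC; exact: seq_event_cell.
    by rewrite -EFinM max_l.
  - by apply/measurable_EFinP; apply: measurable_indic; exact: measurable_cell.
  - by rewrite lee_fin.
rewrite (@integral_partition R X _ _ (Pr x) (Y (size s).+1))//.
- apply: eq_esum => y _; rewrite -ih size_rcons addSnnS; congr integral.
  apply/seteqP; split => w /=.
    move=> [h1 h2] i; rewrite size_rcons /path_state -rcons_cons nth_rcons/= ltnS.
    rewrite leq_eqVlt => /predU1P[->|]; first by rewrite ltnn eqxx.
    by rewrite ltnS => il; rewrite il; exact: h1.
  rewrite /seq_event /path_event/= size_rcons => h; split.
    move=> i il; have := h i (leqW il).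
    by rewrite /path_state -rcons_cons nth_rcons/= ltnS il.
  by rewrite h// /path_state -rcons_cons nth_rcons/= ltnn eqxx.
- exact: measurable_cell_value.
- by move=> w; exact: cell_value_ge0.
Qed.

Lemma measurable_path_sum n x s : measurable_fun [set: RR] (path_sum n x s).
Proof.
elim: n s => [|n ih] s /=.
  apply/measurable_EFinP; apply: measurable_funM; first exact: measurable_cst.
  apply: measurable_funM; first exact: measurable_cst.
  apply: (@measurableT_comp _ _ _ _ _ _ (occupation q x s)).
    exact: (continuous_measurable_fun (@occupation_continuous _ _ q x s)).
  by apply: measurable_maxr; [exact: measurable_id|exact: measurable_cst].
by apply: measurable_fun_esum => y; [exact: ih|move=> t; exact: path_sum_ge0].
Qed.

Let exp_ge0 x (r : R) : (0 <= (q x * expR (q x * r))%:E)%E.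
Proof. by rewrite lee_fin mulr_ge0 ?expR_ge0// ltW// q_gt0. Qed.

Let measurable_exp x :
  measurable_fun [set: RR] (fun r : R => (q x * expR (q x * r))%:E).
Proof.
apply/measurable_EFinP; apply: measurable_funM; first exact: measurable_cst.
exact: (continuous_measurable_fun (@continuous_exp_rate _ (q x))).
Qed.

(** The first-jump decomposition for a fixed number of jumps: the weight releases J x y, and
    [occupation_cons] releases the first holding time. *)
Lemma path_sum_cons n x y s (t : R) : 0 <= t ->
  (path_sum n x (y :: s) t = (J x y * expR (- (q x * t)))%:E *
    \int[mu]_(r in `[0%R, t]) ((q x * expR (q x * r))%:E * path_sum n y s r))%E.
Proof.
move=> t0; have J0 := jump_matrix_ge0 x y.
have c0 : 0 <= J x y * expR (- (q x * t)) by rewrite mulr_ge0 ?expR_ge0.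
elim: n s => [|n ih] s /=.
  rewrite max_l// occupation_cons//.
  pose C := f (last y s) * seq_weight y s.
  pose G r := q x * expR (q x * r) * occupation q y s r.
  have cG : continuous G.
    move=> r; apply: cvgM; last exact: occupation_continuous.
    by apply: cvgM; [exact: cvg_cst|exact: continuous_exp_rate].
  have iG := continuous_integrable t cG.
  transitivity ((J x y * expR (- (q x * t)))%:E * (C%:E * \int[mu]_(r in `[0%R, t])
    (G r)%:E))%E.
    rewrite -[X in (C%:E * X)%E]fineK; last exact: integrable_fin_num iG.
    by rewrite -!EFinM /C; congr EFin; rewrite /primitive /Rintegral -/G; ring.
  congr (_ * _)%E; rewrite -integralZl//.
  apply: eq_integral => r; rewrite inE/= in_itv/= => /andP[r0 _].
  by rewrite -!EFinM max_l// /C /G; congr EFin; ring.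
under eq_esum do rewrite ih.
rewrite esumZl//; last first.
  by move=> z; apply: integral_ge0 => r _; rewrite mule_ge0// path_sum_ge0.
congr (_ * _)%E.
rewrite -integral_esum//.
- apply: eq_integral => r _; rewrite esumZl//; first by have := exp_ge0 x r;
    rewrite lee_fin.
  by move=> z; exact: path_sum_ge0.
- move=> z; apply: measurable_funTS; apply: emeasurable_funM => //.
  exact: measurable_path_sum.
- by move=> z r; rewrite mule_ge0// path_sum_ge0.
Qed.

Definition path_series (t : R) (x : X) : \bar R :=
  (\sum_(n <oo) path_sum n x [::] t)%E.

Lemma path_series_ge0 t x : (0 <= path_series t x)%E.
Proof. by apply: nneseries_ge0 => n _ _; exact: path_sum_ge0. Qed.

Lemma measurable_path_series x : measurable_fun [set: RR] (path_series ^~ x).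
Proof.
apply: ge0_emeasurable_sum => n; first by move=> t _ _; exact: path_sum_ge0.
by move=> _; exact: measurable_path_sum.
Qed.

(** The term n = 0 is the event of no jump; the others are shifted by one with [path_sum_cons]. All
    terms lie in [0, +oo], so sums and integrals are exchanged by Tonelli before finiteness is
    known. *)
Lemma path_series_equation x (t : R) : 0 <= t ->
  (path_series t x = (f x * expR (- (q x * t)))%:E + (expR (- (q x * t)))%:E *
    \int[mu]_(r in `[0%R, t]) ((q x * expR (q x * r))%:E *
      \esum_(y in [set: X]) ((J x y)%:E * path_series r y)))%E.
Proof.
move=> t0; rewrite {1}/path_series nneseries_recl//; last by move=> n _;
  exact: path_sum_ge0.
congr (_ + _)%E.
  by rewrite /= max_l// occupation_nil// mul1r.
have E0 : 0 <= expR (- (q x * t)) by exact: expR_ge0.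
have I0 n y : (0 <= \int[mu]_(r in `[0%R, t])
    ((q x * expR (q x * r))%:E * path_sum n y [::] r))%E.
  by apply: integral_ge0 => r _; rewrite mule_ge0// path_sum_ge0.
rewrite -nneseries_addn; last by move=> n; exact: path_sum_ge0.
rewrite nneseries_esumT; last by move=> n; exact: path_sum_ge0.
transitivity (\esum_(n in [set: nat]) \esum_(y in [set: X])
    ((expR (- (q x * t)))%:E * ((J x y)%:E * \int[mu]_(r in `[0%R, t])
      ((q x * expR (q x * r))%:E * path_sum n y [::] r))))%E.
  apply: eq_esum => n _; rewrite addn1/=; apply: eq_esum => y _.
  by rewrite path_sum_cons// mulrC EFinM muleA.
rewrite esum_exchange; last first.
  by move=> n y; rewrite mule_ge0 ?lee_fin// mule_ge0// lee_fin jump_matrix_ge0.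
transitivity (\esum_(y in [set: X]) ((expR (- (q x * t)))%:E *
   \int[mu]_(r in `[0%R, t]) ((q x * expR (q x * r))%:E * ((J x y)%:E * path_series
     r y))))%E.
  apply: eq_esum => y _.
  rewrite esumZl//; last by move=> n; rewrite mule_ge0// lee_fin jump_matrix_ge0.
  congr (_ * _)%E; rewrite esumZl ?jump_matrix_ge0//.
  rewrite -integral_esum//; last 2 first.
  - move=> n; apply: measurable_funTS; apply: emeasurable_funM => //.
    exact: measurable_path_sum.
  - by move=> n r; rewrite mule_ge0// path_sum_ge0.
  rewrite -ge0_integralZl//; last 3 first.
  - apply: measurable_funTS; apply: measurable_fun_esum => n.
      by apply: emeasurable_funM => //; exact: measurable_path_sum.
    by move=> r; rewrite mule_ge0// path_sum_ge0.
  - by move=> r _; apply: esum_ge0 => n _; rewrite mule_ge0// path_sum_ge0.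
  - by rewrite lee_fin jump_matrix_ge0.
  apply: eq_integral => r _; rewrite esumZl; last 2 first.
  - by have := exp_ge0 x r; rewrite lee_fin.
  - by move=> n; exact: path_sum_ge0.
  rewrite /path_series nneseries_esumT; last by move=> n; exact: path_sum_ge0.
  by rewrite muleCA.
have P0 r y : (0 <= (J x y)%:E * path_series r y)%E.
  by rewrite mule_ge0 ?path_series_ge0// lee_fin jump_matrix_ge0.
have mP y : measurable_fun [set: RR] (fun r => (J x y)%:E * path_series r y)%E.
  by apply: measurable_funeM; exact: measurable_path_series.
rewrite esumZl//; last by move=> y; apply: integral_ge0 => r _; rewrite mule_ge0.
congr (_ * _)%E; rewrite -integral_esum//; last 2 first.
- by move=> y; apply: measurable_funTS; exact: emeasurable_funM.
- by move=> y r; rewrite mule_ge0.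
by apply: eq_integral => r _; rewrite esumZl//; have := exp_ge0 x r;
  rewrite lee_fin.
Qed.

Lemma cell_inj t w m n : cell m t w -> cell n t w -> m = n.
Proof.
have [_ _ S0 _] := chainP.
have J_incr a b : (a <= b)%N -> jump_time S a w <= jump_time S b w.
  move=> ab; rewrite /jump_time -!(big_mkord xpredT (S ^~ w)) (big_cat_nat _ ab)//=
    lerDl.
  by apply: sumr_ge0 => i _; rewrite ltW.
move=> /andP[m1 m2] /andP[n1 n2].
have [mn|nm|//] := ltngtP m n.
  by have := lt_le_trans m2 (J_incr _ _ mn); rewrite ltNge n1.
by have := lt_le_trans n2 (J_incr _ _ nm); rewrite ltNge m1.
Qed.

Lemma state_cell t w n : cell n t w -> state Y S t w = Some (Y n w).
Proof.
move=> cn.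
have [m cm <-] : [set Some (Y n w) | n in [set n | cell n t w]] (state Y S t w).
  by apply: xgetPex; exists (Some (Y n w)); exists n.
by rewrite (cell_inj cm cn).
Qed.

(** At most one cell contains the given time, by [cell_inj]; from the explosion time on there is
    none and both sides are 0. *)
Lemma state_series t w :
  ((oapp f 0 (state Y S t w))%:E = \sum_(n <oo) cell_value t n w)%E.
Proof.
rewrite nneseries_esumT; last by move=> n; exact: cell_value_ge0.
have [[n cn]|nc] := pselect (exists n, cell n t w).
  have c0 (m : nat) : (0 <= cst (f (Y n w))%:E m)%E by rewrite lee_fin.
  rewrite (state_cell cn)/= -[LHS](esum_indic n c0).
  apply: eq_esum => m _; rewrite /cell_value indicE; case: eqP => [->|mn].
    by rewrite mem_set// mulr1.
  rewrite memNset ?mulr0// => cm; apply: mn; exact: cell_inj cm cn.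
rewrite esum1 => [|n _];
  last by rewrite /cell_value indicE memNset ?mulr0// => cn; apply: nc; exists n.
rewrite /state xgetPN// => s [n cn _]; apply: nc; by exists n.
Qed.

Lemma measurable_state t :
  measurable_fun [set: Omega] (fun w => (oapp f 0 (state Y S t w))%:E).
Proof.
under eq_fun do rewrite state_series.
apply: ge0_emeasurable_sum => n; first by move=> w _ _; exact: cell_value_ge0.
by move=> _; exact: measurable_cell_value.
Qed.

Lemma expectation_state (t : R) x : 0 <= t ->
  ('E_(Pr x)[fun w => oapp f 0%R (state Y S t w)] = path_series t x)%E.
Proof.
move=> t0; have [mY mS _ law] := chainP.
rewrite unlock; under eq_integral do rewrite state_series.
rewrite integral_nneseries//; last 2 first.
- by move=> n; exact: measurable_cell_value.
- by move=> n w _; exact: cell_value_ge0.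
apply: eq_eseriesr => n _.
rewrite (@integral_partition R X _ _ (Pr x) (Y 0))//; last 2 first.
- exact: measurable_cell_value.
- by move=> w; exact: cell_value_ge0.
rewrite -(@integral_seq_event n x [::] t t0) add0n.
have c0 (y : X) : (0 <= cst (\int[Pr x]_(w in seq_event x [::]) cell_value t n w)
  y)%E.
  by apply: integral_ge0 => w _; exact: cell_value_ge0.
rewrite -[RHS](esum_indic x c0); apply: eq_esum => y _.
case: eqP => [->|/eqP yx].
  congr integral; apply/seteqP; split => w /=.
    by move=> [_ h] i; rewrite leqn0 => /eqP ->.
  by move=> h; split => //; exact: h.
rewrite setTI.
(* Under Pr x the jump chain starts at x, so the other starting points form null events. *)
have P0 : Pr x [set w | Y 0 w = y] = 0%E.
  have := law x 0 (fun=> y) (fun=> setT) (fun=> measurableT).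
  rewrite (negPf yx) !mul0r => e; apply: etrans e; congr (Pr x _); apply/seteqP;
    split => w /=.
    by move=> h i; rewrite leqn0 => /eqP ->.
  by move=> h; have [] := h 0 (leqnn _).
apply: null_set_integral => //.
by apply: measurable_funTS; exact: measurable_cell_value.
Qed.
End path_expansion.

(** * The backward equation *)
Section backward_equation.
Context {R : realType} {X : countType} (k : X -> X -> R).
Context (d : measure_display) (Omega : measurableType d).
Variables (Pr : X -> probability Omega R).
Variables (Y : nat -> Omega -> X) (S : nat -> Omega -> R).
Hypothesis k_rates : transition_rates k.
Hypothesis M1_fin : forall x, (M1 k x < +oo)%E.
Hypothesis chainP : is_markov_chain k Pr Y S.
Variables (f : X -> R) (b : R).
Hypothesis f_ge0 : forall x, 0 <= f x.
Hypothesis f_le : forall x, f x <= b.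
Hypothesis b_ge0 : 0 <= b.
Local Notation RR := (measurableTypeR R).
Local Notation mu := (@lebesgue_measure R).
Local Notation q := (exit_rate k).
Local Notation kk := (off_diag k).

Let k_ge0 x y : x != y -> 0 <= k x y.
Proof. by case: k_rates => h _ _; exact: h. Qed.
Let q_gt0 x : 0 < q x. Proof. exact: exit_rate_gt0. Qed.

Lemma path_series_max (t : R) x : path_series k f t x =
  path_series k f (Num.max t 0) x.
Proof.
have e n s : path_sum k f n x s t = path_sum k f n x s (Num.max t 0).
  elim: n s => [|n ih] s /=; first by rewrite -maxA maxxx.
  by apply: eq_esum => y _; exact: ih.
by rewrite /path_series; apply: eq_eseriesr => n _; exact: e.
Qed.

Lemma path_series_le (t : R) x : (path_series k f t x <= b%:E)%E.
Proof.
rewrite path_series_max; set s := Num.max t 0.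
have s0 : 0 <= s by rewrite le_max lexx orbT.
rewrite -(expectation_state chainP q_gt0 f_ge0 x s0) unlock.
have -> : b%:E = (\int[Pr x]_(w in [set: Omega]) b%:E)%E.
  by rewrite integral_cst//= probability_setT mule1.
apply: ge0_le_integral => //.
- by move=> w _; rewrite lee_fin; case: (state _ _ _ _) => //=.
- exact: (measurable_state chainP f_ge0).
- by move=> w _; rewrite lee_fin; case: (state _ _ _ _) => //=.
Qed.

Definition heat (t : R) (x : X) : R := fine (path_series k f t x).

Lemma path_seriesE t x : path_series k f t x = (heat t x)%:E.
Proof.
rewrite /heat fineK// ge0_fin_numE; last exact: path_series_ge0.
by apply: le_lt_trans (path_series_le t x) _; rewrite ltry.
Qed.

Lemma heat_ge0 t x : 0 <= heat t x.
Proof. by rewrite -lee_fin -path_seriesE; exact: path_series_ge0. Qed.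

Lemma heat_le t x : heat t x <= b.
Proof. by rewrite -lee_fin -path_seriesE path_series_le. Qed.

Lemma heat_norm t x : `|heat t x| <= b.
Proof. by rewrite ger0_norm ?heat_ge0 ?heat_le. Qed.

Lemma heat_semigroup (t : R) x : 0 <= t -> heat t x = semigroup Pr Y S t f x.
Proof. by move=> t0; rewrite /heat -(expectation_state chainP q_gt0 f_ge0 x t0).
  Qed.

Definition jump_mean (r : R) (x : X) : R := rsum (fun y => kk x y * heat r y).

Lemma summableR_jump_mean r x : summableR (fun y => kk x y * heat r y).
Proof.
apply: (@le_summableR _ _ _ (fun y => b * kk x y)); last by apply: summableRZ;
  exact: summableR_off_diag.
move=> y; rewrite normrM ger0_norm ?off_diag_ge0// mulrC.
by apply: ler_wpM2r; [exact: off_diag_ge0|exact: heat_norm].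
Qed.

Lemma jump_mean_ge0 r x : 0 <= jump_mean r x.
Proof. by apply: rsum_ge0 => y; rewrite mulr_ge0 ?off_diag_ge0 ?heat_ge0. Qed.

Lemma jump_mean_le r x : jump_mean r x <= b * q x.
Proof.
rewrite -(rsum_off_diag k_rates M1_fin) -rsumZ; last exact: summableR_off_diag.
apply: le_rsum; [exact: summableR_jump_mean|by apply: summableRZ;
  exact: summableR_off_diag|].
by move=> y; rewrite mulrC; apply: ler_wpM2r; [exact: off_diag_ge0|exact: heat_le].
Qed.

Lemma jump_meanE r x : ((jump_mean r x)%:E =
  (q x)%:E * \esum_(y in [set: X]) ((jump_matrix k x y)%:E * path_series k f r
    y))%E.
Proof.
have J0 y : 0 <= jump_matrix k x y by exact: (jump_matrix_ge0 k_ge0 q_gt0).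
rewrite -esumZl; [|exact: ltW|by move=> y;
  rewrite mule_ge0 ?lee_fin ?path_series_ge0].
rewrite rsum_esum; [|exact: summableR_jump_mean|by move=> y;
  rewrite mulr_ge0 ?off_diag_ge0 ?heat_ge0].
apply: eq_esum => y _; rewrite path_seriesE -!EFinM mulrA; congr (_ * _)%:E.
rewrite /off_diag /jump_matrix eq_sym; case: ifP => _; first by rewrite mulr0.
by rewrite -/(q x) mulrCA divff ?mulr1// gt_eqF.
Qed.

Lemma measurable_jump_mean x : measurable_fun [set: RR] (jump_mean ^~ x).
Proof.
apply/measurable_EFinP.
rewrite (_ : _ \o _ = fun r => ((q x)%:E *
    \esum_(y in [set: X]) ((jump_matrix k x y)%:E * path_series k f r y))%E);
      last first.
  by apply/funext => r; rewrite /= jump_meanE.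
apply: measurable_funeM; apply: measurable_fun_esum => [y|y r].
  by apply: measurable_funeM; exact: measurable_path_series.
by rewrite mule_ge0 ?lee_fin ?path_series_ge0// (jump_matrix_ge0 k_ge0 q_gt0).
Qed.

Let G x (r : R) : R := expR (q x * r) * jump_mean r x.

Let mG x (T : R) : measurable_fun `[0, T] (G x).
Proof.
apply: measurable_funTS; apply: measurable_funM; last exact: measurable_jump_mean.
exact: (continuous_measurable_fun (@continuous_exp_rate _ (q x))).
Qed.

Let bG x : locally_bounded (G x).
Proof.
move=> T; exists (expR (q x * T) * (b * q x)) => r r0 rT.
rewrite ger0_norm ?mulr_ge0 ?expR_ge0 ?jump_mean_ge0//.
rewrite ler_pM ?expR_ge0 ?jump_mean_ge0 ?jump_mean_le//.
by rewrite ler_expR ler_wpM2l// ltW.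
Qed.

(** The first-jump equation in real form: the rate q of the exponential density cancels the
    denominator of the jump matrix, as [jump_meanE] records. *)
Lemma heatE (t : R) x : 0 <= t ->
  heat t x = expR (- (q x * t)) * (f x + primitive (G x) t).
Proof.
move=> t0; apply: EFin_inj; rewrite -path_seriesE.
rewrite (path_series_equation k_ge0 q_gt0 f_ge0 x t0).
have iG : mu.-integrable `[0, t] (EFin \o G x).
  by have [C GC] := bG x t; apply: (@bounded_integrable _ _ _ _ C).
have -> : (\int[mu]_(r in `[0%R, t]) ((q x * expR (q x * r))%:E *
    \esum_(y in [set: X]) ((jump_matrix k x y)%:E * path_series k f r y)))%E =
    (primitive (G x) t)%:E.
  rewrite /primitive /Rintegral fineK; last exact: integrable_fin_num iG.
  apply: eq_integral => r _; rewrite mulrC EFinM -muleA -jump_meanE.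
  by rewrite -EFinM.
by rewrite -EFinM -EFinD; congr EFin; rewrite -/(q x); ring.
Qed.

Lemma heat_max (t : R) x : heat t x = heat (Num.max t 0) x.
Proof. by rewrite /heat path_series_max. Qed.

Lemma heat0 x : heat 0 x = f x.
Proof. by rewrite heatE// primitive0 mulr0 oppr0 expR0 mul1r addr0. Qed.

Lemma continuous_max0 : continuous (fun t : R => Num.max t 0).
Proof.
have -> : (fun t : R => Num.max t 0) = fun t => 2^-1 * (t + `|t|).
  apply/funext => t; have [t0|t0] := leP t 0.
    by rewrite ler0_norm// subrr mulr0.
  by rewrite gtr0_norm//; field.
move=> t; apply: cvgM; first exact: cvg_cst.
by apply: cvgD; [exact: cvg_id|apply: cvg_norm; exact: cvg_id].
Qed.

(** First step of a bootstrap: a measurable, locally bounded G already makes [heat] continuous. Then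
    [jump_mean], hence G, is continuous by dominated convergence, and the primitive becomes
    differentiable at positive times. *)
Lemma heat_continuous x : continuous (heat ^~ x).
Proof.
have -> : heat ^~ x = (fun t => expR (- q x * t) * (f x + primitive (G x) t)) \o
  (fun t => Num.max t 0).
  by apply/funext => t; rewrite heat_max/= heatE ?mulNr// le_max lexx orbT.
move=> t; apply: continuous_comp; first exact: continuous_max0.
apply: cvgM; first exact: continuous_exp_rate.
apply: cvgD; first exact: cvg_cst.
exact: primitive_continuous.
Qed.

Lemma jump_mean_continuous x : continuous (jump_mean ^~ x).
Proof.
move=> t; have sb : summableR (fun y => b * kk x y) by apply: summableRZ;
  exact: summableR_off_diag.
have bd r y : `|kk x y * heat r y| <= b * kk x y.
  rewrite normrM ger0_norm ?off_diag_ge0// mulrC.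
  by apply: ler_wpM2r; [exact: off_diag_ge0|exact: heat_norm].
apply: (rsum_cvg sb).
- by apply: nearW => r y; exact: bd.
- by move=> y; exact: bd.
- by move=> y; apply: cvgM; [exact: cvg_cst|exact: heat_continuous].
Qed.

Lemma heat_derive (t : R) x : 0 < t ->
  is_derive t 1 (heat ^~ x) (markov_generator k (heat t) x).
Proof.
move=> t0.
have cG : continuous (G x).
  by move=> r; apply: cvgM;
    [exact: continuous_exp_rate|exact: jump_mean_continuous].
have dP := primitive_derive (mG x) (bG x) t0 (cG t).
have -> : markov_generator k (heat t) x = jump_mean t x - q x * heat t x.
  rewrite generatorE.
  have -> : (fun y => kk x y * (heat t y - heat t x)) =
      fun y => kk x y * heat t y - heat t x * kk x y.
    by apply/funext => y; ring.
  rewrite rsumB; [|exact: summableR_jump_mean|by apply: summableRZ;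
    exact: summableR_off_diag].
  by rewrite rsumZ ?(rsum_off_diag k_rates M1_fin) 1?mulrC//;
    exact: summableR_off_diag.
apply: (@near_eq_is_derive _ _ _ (fun t => expR (- (q x * t)) * (f x + primitive (G
  x) t))).
  near=> s; rewrite heatE// ltW//; near: s; exact: lt_nbhsr.
apply: is_derive_eq; rewrite /GRing.scale/= heatE; last exact: ltW.
rewrite /G !expRN; field; rewrite gt_eqF// expR_gt0.
Unshelve. all: by end_near. Qed.

End backward_equation.

(** * Lower bounds from non-explosion *)

Section lower_bound.
Context {R : realType} {X : countType} (k : X -> X -> R).
Context (d : measure_display) (Omega : measurableType d).
Variables (Pr : X -> probability Omega R).
Variables (Y : nat -> Omega -> X) (S : nat -> Omega -> R).
Hypothesis k_rates : transition_rates k.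
Hypothesis chainP : is_markov_chain k Pr Y S.
Hypothesis Pt1 : non_explosive Pr Y S.

(** After explosion the state counts as 0, so positivity alone gives P_t f >= a P_t 1; non-explosion
    turns this into a. *)
Lemma heat_ge (f : X -> R) (a b t : R) (x : X) : 0 <= a -> (forall x, a <= f x) ->
  (forall x, f x <= b) -> a <= heat k f t x.
Proof.
move=> a0 fa fb.
have f0 y : 0 <= f y by exact: le_trans (fa y).
have b0 : 0 <= b by exact: le_trans (fb x).
have q_gt0 y : 0 < exit_rate k y by exact: exit_rate_gt0.
rewrite heat_max; set s := Num.max t 0.
have s0 : 0 <= s by rewrite le_max lexx orbT.
rewrite -lee_fin -(path_seriesE k_rates chainP f0 fb b0).
rewrite -(expectation_state chainP q_gt0 f0 x s0) unlock.
have c0 (y : X) : 0 <= cst 1 y :> R by [].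
have c1 (y : X) : cst 1 y <= 1 :> R by [].
have E1 : (\int[Pr x]_w (oapp (cst 1) 0 (state Y S s w))%:E = 1)%E.
  have := expectation_state chainP q_gt0 c0 x s0; rewrite unlock => ->.
  rewrite (path_seriesE k_rates chainP c0 c1 ler01).
  by rewrite (heat_semigroup k_rates chainP c0 x s0) Pt1.
have -> : a%:E = (\int[Pr x]_w (a%:E * (oapp (cst 1) 0 (state Y S s w))%:E))%E.
  rewrite ge0_integralZl//; first by rewrite E1 mule1.
  - exact: (measurable_state chainP c0).
  - by move=> w _; rewrite lee_fin; case: (state Y S s w) => //=.
apply: ge0_le_integral => //.
- by move=> w _; rewrite mule_ge0 ?lee_fin//; case: (state Y S s w) => //=.
- by apply: measurable_funeM; exact: (measurable_state chainP c0).
- exact: (measurable_state chainP f0).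
- by move=> w _; rewrite -EFinM lee_fin; case: (state Y S s w) => [y|]/=;
    rewrite ?mulr1 ?mulr0.
Qed.

End lower_bound.

(** * Truncation and the general case *)
Section truncation.
Context {R : realType}.
Implicit Types s r e N : R.

Definition clip e N s : R := Num.min (Num.max s e) N.

Lemma clip_ge e N s : e <= N -> e <= clip e N s.
Proof. by move=> eN; rewrite /clip le_min eN le_max lexx orbT. Qed.

Lemma clip_le e N s : clip e N s <= N.
Proof. by rewrite /clip ge_min lexx orbT. Qed.

(** Take r <= s. If s <= e or N <= r, both clipped values agree and the left side is 0. Otherwise
    clipping lowers s and raises r, so neither the difference nor the ratio increases. *)
Lemma clip_contraction e N s r : 0 < e -> e <= N -> 0 < s -> 0 < r ->
  (clip e N s - clip e N r) * (ln (clip e N s) - ln (clip e N r)) <=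
  (s - r) * (ln s - ln r).
Proof.
move=> e0 eN; wlog rs : s r / r <= s.
  move=> h s0 r0; have [rs|/ltW sr] := leP r s; first exact: h.
  by have := h r s sr r0 s0; lra.
move=> s0 r0.
have lsr : ln r <= ln s by rewrite ler_ln ?posrE.
have [se|es] := leP s e.
  have ce x : x <= e -> clip e N x = e by move=> xe; rewrite /clip max_r// min_l.
  rewrite (ce s se) (ce r (le_trans rs se)) subrr mul0r.
  by rewrite mulr_ge0// subr_ge0.
have [Nr|rN] := leP N r.
  have cN x : N <= x -> clip e N x = N.
    by move=> Nx; rewrite /clip max_l ?min_r// (le_trans eN).
  rewrite (cN s (le_trans Nr rs)) (cN r Nr) subrr mul0r.
  by rewrite mulr_ge0// subr_ge0.
have cs : clip e N s = Num.min s N by rewrite /clip max_l// ltW.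
have cr : clip e N r = Num.max r e.
  by rewrite /clip min_l// ge_max eN (ltW rN).
have h1 : clip e N r <= clip e N s.
  by rewrite cr cs ge_max !le_min rs (ltW rN) (ltW es) eN.
have css : clip e N s <= s by rewrite cs ge_min lexx.
have rcr : r <= clip e N r by rewrite cr le_max lexx.
have cr0 : 0 < clip e N r by exact: lt_le_trans rcr.
have cs0 : 0 < clip e N s by exact: lt_le_trans h1.
have h2 : clip e N s - clip e N r <= s - r by rewrite lerB.
have h3 : clip e N s * r <= s * clip e N r by apply: ler_pM => //; exact: ltW.
have l1 : 0 <= ln (clip e N s) - ln (clip e N r) by rewrite subr_ge0 ler_ln ?posrE.
have l2 : ln (clip e N s) - ln (clip e N r) <= ln s - ln r.
  by rewrite lerBlDr -addrAC lerBrDr -!lnM ?posrE// ler_ln ?posrE ?mulr_gt0//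
    (mulrC _ (clip e N r)) (mulrC (clip e N r)).
by apply: ler_pM => //; rewrite subr_ge0.
Qed.

Lemma mul_ln_ge s : 0 < s -> - 1 <= s * ln s.
Proof.
move=> s0; have := @ln_le_subr1 _ s^-1; rewrite invr_gt0 => /(_ s0).
rewrite lnV ?posrE// => /(ler_wpM2l (ltW s0)).
by rewrite mulrN mulrBr divff ?gt_eqF// mulr1; lra.
Qed.

(** A dominating function independent of e and N: |u ln u| <= 1 on ]0, 1], while u ln u is
    increasing above 1. *)
Lemma norm_clip_ln e N s : 0 < e -> e <= 1 -> 1 <= N -> 0 < s ->
  `|clip e N s * ln (clip e N s)| <= `|s * ln s| + 1.
Proof.
move=> e0 e1 N1 s0.
have low (u : R) : 0 < u -> u <= 1 -> `|u * ln u| <= 1.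
  move=> u0 u1; have l0 : ln u <= 0 by exact: ln_le0.
  rewrite ler0_norm; last by rewrite mulr_ge0_le0// ltW.
  by rewrite lerNl; exact: mul_ln_ge.
have h := normr_ge0 (s * ln s).
have [se|es] := ltP s e.
  have -> : clip e N s = e.
    by rewrite /clip /Num.max se min_l// (le_trans e1).
  by have := low e e0 e1; lra.
have [sN|Ns] := leP s N.
  have -> : clip e N s = s by rewrite /clip max_l// min_l.
  lra.
have -> : clip e N s = N by rewrite /clip max_l// min_r// ltW.
have N0 : 0 < N by exact: lt_le_trans N1.
have lN : 0 <= ln N by rewrite ln_ge0.
have ls : ln N <= ln s by rewrite ler_ln ?posrE// ltW.
rewrite !ger0_norm ?mulr_ge0 ?(ltW s0) ?(ltW N0)//; last exact: le_trans ls.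
have : N * ln N <= s * ln s by apply: ler_pM => //; rewrite ltW.
lra.
Qed.

Lemma clip_cvg s : 0 < s -> clip n.+1%:R^-1 n.+1%:R s @[n --> \oo] --> s.
Proof.
move=> s0; apply: cvg_near_cst; near=> n.
have n0 : (0 : R) < n.+1%:R by rewrite ltr0n.
have h1 : s <= n.+1%:R.
  have : s <= n%:R by near: n; exact: nbhs_infty_ger.
  by move=> /le_trans; apply; rewrite ler_nat.
have h2 : n.+1%:R^-1 <= s.
  rewrite -[leRHS]invrK lef_pV2 ?posrE ?invr_gt0//.
  have : s^-1 <= n%:R by near: n; exact: nbhs_infty_ger.
  by move=> /le_trans; apply; rewrite ler_nat.
by rewrite /clip max_l// min_l.
Unshelve. all: by end_near. Qed.

End truncation.

(** * The inequality for bounded densities, then for densities of finite entropy *)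

Section log_sobolev.
Context {R : realType} {X : countType} (k : X -> X -> R).
Context (d : measure_display) (Omega : measurableType d).
Variables (Pr : X -> probability Omega R).
Variables (Y : nat -> Omega -> X) (S : nat -> Omega -> R).
Variables (pi : X -> R) (kappa : R).
Hypothesis k_rates : transition_rates k.
Hypothesis k_irr : irreducible_rates k.
Hypothesis chainP : is_markov_chain k Pr Y S.
Hypothesis pi_prob : probability_density pi.
Hypothesis pi_db : detailed_balance k pi.
Hypothesis M1_fin : forall x, (M1 k x < +oo)%E.
Hypothesis M2_fin : forall x, (M2 k x < +oo)%E.
Hypothesis Pt1 : non_explosive Pr Y S.
Hypothesis kappa_gt0 : 0 < kappa.
Hypothesis CD : CD_Upsilon k kappa.
Hypothesis M1_l2 : in_lp pi 2 (M1 k).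

Let pi0 x : 0 < pi x. Proof. exact: pi_gt0 pi_prob x. Qed.

Section bounded.
Variables (f : X -> R) (a b : R).
Hypothesis a_gt0 : 0 < a.
Hypothesis f_ge : forall x, a <= f x.
Hypothesis f_le : forall x, f x <= b.
Hypothesis f_mass : rsum (fun x => f x * pi x) = 1.

Let f_ge0 x : 0 <= f x. Proof. exact/ltW/(lt_le_trans a_gt0). Qed.
Let b_ge0 : 0 <= b.
Proof.
(* No point of X is given; total mass 1 rules out that X is empty. *)
have [[x _]|X0] := pselect (exists x : X, True).
  exact: le_trans (f_ge0 x) (f_le x).
move: f_mass; rewrite (@rsum_fset _ _ fset0) => [|y _]; last by exfalso;
  apply: X0; exists y.
by rewrite big_seq_fset0 => /eqP; rewrite eq_sym oner_eq0.
Qed.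

Let u := heat k f.
Let u_ge t x : a <= u t x.
Proof. exact: (heat_ge k_rates chainP Pt1 t x (ltW a_gt0) f_ge f_le). Qed.
Let u_le t x : u t x <= b.
Proof. exact: (heat_le k_rates chainP f_ge0 f_le b_ge0). Qed.
Let u_cont x : continuous (u ^~ x).
Proof. exact: (heat_continuous k_rates M1_fin chainP f_ge0 f_le b_ge0). Qed.
Let u_der (t : R) x : 0 < t -> is_derive t 1 (u ^~ x) (markov_generator k (u t) x).
Proof. exact: (heat_derive k_rates M1_fin chainP f_ge0 f_le b_ge0). Qed.
Let u0 : u 0 = f.
Proof. by apply/funext => x;
  exact: (heat0 k_rates M1_fin chainP f_ge0 f_le b_ge0). Qed.
Let u0_mass : rsum (fun x => u 0 x * pi x) = 1. Proof. by rewrite u0. Qed.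

Lemma log_sobolev_bounded :
  rsum (fun x => f x * ln (f x) * pi x) <= (2 * kappa)^-1 * fisher k pi f.
Proof.
have := log_sobolev_along k_rates pi_prob pi_db M1_fin M2_fin M1_l2 k_irr a_gt0
  b_ge0 u_ge u_le u_cont u_der u0_mass kappa_gt0 CD (lexx 0).
by rewrite /entropy_along u0.
Qed.

Let smf t : summableR (fun x => u t x * ln (u t x) * pi x).
Proof.
apply: (@le_summableR _ _ _ (fun x => b * (`|ln a| + `|ln b|) * pi x)).
  move=> x; rewrite !normrM ler_pM ?mulr_ge0//; last by rewrite gtr0_norm.
  apply: ler_pM => //; last exact: ln_rho_norm a_gt0 (u_ge t) (u_le t) x.
  exact: rho_norm a_gt0 (u_ge t) (u_le t) x.
by apply: summableRZ; exact: summableR_pi.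
Qed.

Lemma entropy_decay_bounded (t : R) : 0 <= t ->
  (entropy pi (semigroup Pr Y S t f) <= (expR (- (2 * kappa * t)))%:E * entropy pi
    f)%E.
Proof.
move=> t0.
have e : semigroup Pr Y S t f = u t.
  by apply/funext => x; rewrite -(heat_semigroup k_rates chainP f_ge0 x t0).
have sf := smf 0; rewrite u0 in sf.
rewrite e /entropy (signed_esumE (smf t)) (signed_esumE sf) -EFinM lee_fin.
have := entropy_along_decay k_rates pi_prob pi_db M1_fin M2_fin M1_l2 k_irr a_gt0
  b_ge0 u_ge u_le u_cont u_der u0_mass kappa_gt0 CD t0.
by rewrite /entropy_along u0.
Qed.

End bounded.

Lemma fisher_termE (f : X -> R) (p : X * X) :
  k p.1 p.2 * (f p.2 - f p.1) * (ln (f p.2) - ln (f p.1)) * pi p.1 =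
  flow k pi p * (grad f p * grad (fun x => ln (f x)) p).
Proof.
rewrite /flow /off_diag /grad; case: eqP => [->|_]; last by ring.
by rewrite !subrr !(mulr0, mul0r).
Qed.

Let grad_ln_ge0 (f : X -> R) p : (forall x, 0 < f x) ->
  0 <= flow k pi p * (grad f p * grad (fun x => ln (f x)) p).
Proof.
move=> f0; apply: (mulr_ge0 (flow_ge0 k_rates pi_prob p)); rewrite /grad.
have [h|/ltW h] := leP (f p.1) (f p.2).
  by rewrite mulr_ge0// subr_ge0// ler_ln ?posrE.
by rewrite mulr_le0// subr_le0// ler_ln ?posrE.
Qed.

Lemma Fisher_information_ge0 (f : X -> R) : (forall x, 0 < f x) ->
  (0 <= Fisher_information pi k f)%E.
Proof.
move=> f0; rewrite mule_ge0 ?lee_fin// esum_ge0// => p _.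
by rewrite lee_fin fisher_termE grad_ln_ge0.
Qed.

(** Meant for g a truncation of f divided by its mass, with C the inverse of that mass: in the
    Fisher term the logarithm ignores the normalization, so the factor appears only once. *)
Lemma fisher_le (f g : X -> R) (a b C : R) : 0 < a -> 0 <= C ->
  (forall x, 0 < f x) ->
  (forall x, a <= g x) -> (forall x, g x <= b) ->
  (forall x y, (g y - g x) * (ln (g y) - ln (g x)) <=
    C * ((f y - f x) * (ln (f y) - ln (f x)))) ->
  ((fisher k pi g)%:E <= C%:E * Fisher_information pi k f)%E.
Proof.
move=> a0 C0 f0 ga gb gf; rewrite /Fisher_information /fisher EFinM muleCA.
apply: lee_wpmul2l; first by rewrite lee_fin.
have g0 x : 0 < g x by exact: lt_le_trans (ga x).
have dg : dominated k (fun p => grad g p * grad (fun x => ln (g x)) p).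
  apply: (dominatedM (grad_bounded (rho_norm a0 ga gb))).
  apply: dominated_grad => //; apply: (rate_bounded_cst k_rates).
  exact: ln_rho_norm a0 ga gb.
rewrite /flow_sum rsum_esum; last 2 first.
- exact: (summableR_flow k_rates pi_prob pi_db M1_fin M1_l2 dg).
- by move=> p; exact: grad_ln_ge0.
rewrite -esumZl//; last by move=> p; rewrite lee_fin fisher_termE grad_ln_ge0.
apply: le_esum => p _; rewrite -EFinM lee_fin fisher_termE [leRHS]mulrCA.
by apply: ler_wpM2l; [exact: flow_ge0|exact: gf].
Qed.

(** Since s ln s >= -1 and pi has mass 1, the negative part is summable, so a finite entropy bounds
    the positive part as well. *)
Lemma summableR_entropy_density (f : X -> R) : (forall x, 0 < f x) ->
  (entropy pi f < +oo)%E -> summableR (fun x => f x * ln (f x) * pi x).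
Proof.
move=> f0; rewrite /entropy /signed_esum;
  set phi := fun x => (f x * ln (f x) * pi x)%:E.
have N_fin : (\esum_(x in [set: X]) (phi^\-)%E x < +oo)%E.
  apply: (@le_lt_trans _ _ (\esum_(x in [set: X]) (pi x)%:E)%E).
    apply: le_esum => x _; rewrite funenegE ge_max !lee_fin (ltW (pi0 x)) andbT.
    have := ler_wpM2r (ltW (pi0 x)) (mul_ln_ge (f0 x)); lra.
  by case: pi_prob => _ ->; rewrite ltry.
move=> H; have P_fin : (\esum_(x in [set: X]) (phi^\+)%E x < +oo)%E.
  rewrite ltNge leye_eq; apply/negP => /eqP e; move: H; rewrite e.
  by rewrite addye ?ltxx// eqe_oppLR/= lt_eqF.
rewrite summableRE; under eq_esum do rewrite -abse_EFin -/(phi _).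
have -> : (\esum_(x in [set: X]) `|phi x| =
  \esum_(x in [set: X]) (phi^\+ x + phi^\- x))%E.
  by apply: eq_esum => x _; rewrite -/((abse \o phi) x) fune_abse.
by rewrite esumD// lte_add_pinfty.
Qed.

Lemma log_sobolev (f : X -> R) : P_star pi f -> (entropy pi f < +oo)%E ->
  (entropy pi f <= ((2 * kappa)^-1)%:E * Fisher_information pi k f)%E.
Proof.
move=> [f0 fpi] Hf; have k0 : 0 < 2 * kappa by rewrite mulr_gt0.
have sphi := summableR_entropy_density f0 Hf.
have I0 := Fisher_information_ge0 f0.
have [Iy|Ifin] := eqVneq (Fisher_information pi k f) +oo%E.
  by rewrite Iy gt0_muley ?leey// lte_fin invr_gt0.
have {}Ifin : Fisher_information pi k f \is a fin_num by rewrite ge0_fin_numE//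
  ltey.
rewrite -(fineK Ifin) /entropy signed_esumE// -EFinM lee_fin.
set I := fine (Fisher_information pi k f).
have p0 x : 0 <= f x * pi x by rewrite mulr_ge0// ltW.
have sfpi : summableR (fun x => f x * pi x).
  by rewrite summableRE; under eq_esum do rewrite ger0_norm//; rewrite fpi ltry.
have mass : rsum (fun x => f x * pi x) = 1 by rewrite /rsum rsum_ge0E// fpi.
pose eps n : R := n.+1%:R^-1.
pose F n x := clip (eps n) n.+1%:R (f x).
have eps0 n : 0 < eps n by rewrite invr_gt0 ltr0n.
have N1 n : (1 : R) <= n.+1%:R by rewrite ler1n.
have eps1 n : eps n <= 1 by rewrite invf_le1 ?ltr0n.
have epsN n : eps n <= n.+1%:R by exact: le_trans (N1 n).
have Fge n x : eps n <= F n x by exact: clip_ge.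
have Fle n x : F n x <= n.+1%:R by exact: clip_le.
have F0 n x : 0 < F n x by exact: lt_le_trans (Fge n x).
have Ff n x : F n x <= f x + 1.
  by rewrite /F /clip ge_min ge_max lerDl ler01/= (le_trans (eps1 n)) ?orbT// lerDr
    ltW.
have sF n : summableR (fun x => F n x * pi x).
  apply: (@le_summableR _ _ _ (fun x => n.+1%:R * pi x));
    last by apply: summableRZ; exact: summableR_pi.
  by move=> x; rewrite ger0_norm ?mulr_ge0 ?(ltW (F0 n x)) ?(ltW (pi0 x))//
    ler_wpM2r// ltW.
pose c n := rsum (fun x => F n x * pi x).
have c0 n : 0 < c n.
  apply: (@lt_le_trans _ _ (rsum (fun x => eps n * pi x))).
    by rewrite rsumZ ?(rsum_pi pi_prob) ?mulr1//; exact: summableR_pi.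
  apply: le_rsum => //; first by apply: summableRZ; exact: summableR_pi.
  by move=> x; rewrite ler_wpM2r// ltW.
have spi1 : summableR (fun x => `|f x * ln (f x) * pi x| + pi x).
  by apply: summableRD; [exact: summableR_norm|exact: summableR_pi].
have FlnF n x : `|F n x * ln (F n x) * pi x| <= `|f x * ln (f x) * pi x| + pi x.
  rewrite [X in X <= _]normrM [X in _ <= X + _]normrM (gtr0_norm (pi0 x)).
  have := ler_wpM2r (ltW (pi0 x)) (norm_clip_ln (eps0 n) (eps1 n) (N1 n) (f0 x)).
  by rewrite mulrDl mul1r.
pose A n := rsum (fun x => F n x * ln (F n x) * pi x).
have sA n : summableR (fun x => F n x * ln (F n x) * pi x) by exact: le_summableR
  (FlnF n) spi1.
(* Entropy and Fisher information of the normalized truncation both carry the factor 1 / c n, which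
   cancels; as c n tends to 1, the correction c n ln (c n) tends to 0. *)
have main n : A n - c n * ln (c n) <= (2 * kappa)^-1 * I.
  pose g x := (c n)^-1 * F n x.
  have ci : 0 < (c n)^-1 by rewrite invr_gt0.
  have g_ge x : (c n)^-1 * eps n <= g x by apply: ler_wpM2l => //; exact: ltW.
  have g_le x : g x <= (c n)^-1 * n.+1%:R by apply: ler_wpM2l => //; exact: ltW.
  have a0 : 0 < (c n)^-1 * eps n by exact: mulr_gt0.
  have gE x : ln (g x) = ln (F n x) - ln (c n) by rewrite /g mulrC ln_div ?posrE.
  have gmass : rsum (fun x => g x * pi x) = 1.
    rewrite -(mulVf (lt0r_neq0 (c0 n))) -rsumZ//; congr rsum; apply/funext => x.
    by rewrite /g mulrA.
  have h1 := log_sobolev_bounded a0 g_ge g_le gmass.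
  have h2 : fisher k pi g <= (c n)^-1 * I.
    have IE : I%:E = Fisher_information pi k f by rewrite /I fineK.
    rewrite -lee_fin [leRHS]EFinM IE.
    apply: (fisher_le a0 (ltW ci) f0 g_ge g_le) => x y.
    rewrite !gE /g -mulrBr -mulrA ler_wpM2l ?(ltW ci)//.
    rewrite opprB addrA subrK.
    exact: clip_contraction.
  have e : rsum (fun x => g x * ln (g x) * pi x) =
    (c n)^-1 * (A n - c n * ln (c n)).
    rewrite mulrC [c n * _]mulrC -rsumZ// -rsumB//; last exact: summableRZ.
    rewrite mulrC -rsumZ; last by apply: summableRB => //; exact: summableRZ.
    by congr rsum; apply/funext => x; rewrite gE /g; ring.
  rewrite e in h1; have := le_trans h1 (ler_wpM2l (ltW (_ : 0 < (2 * kappa)^-1))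
    h2).
  by rewrite invr_gt0 => /(_ k0); rewrite mulrCA ler_pM2l.
have cc : c n @[n --> \oo] --> (1 : R).
  rewrite -mass.
  have s1 : summableR (fun x => f x * pi x + pi x) by apply: summableRD => //;
    exact: summableR_pi.
  apply: (rsum_cvg s1).
  - apply: nearW => n x; rewrite ger0_norm ?mulr_ge0 ?(ltW (F0 n x)) ?(ltW (pi0
      x))//.
    by have := ler_wpM2r (ltW (pi0 x)) (Ff n x); rewrite mulrDl mul1r.
  - by move=> x; rewrite ger0_norm// lerDl ltW.
  - by move=> x; apply: cvgM; [exact: clip_cvg|exact: cvg_cst].
have cA : A n @[n --> \oo] --> rsum (fun x => f x * ln (f x) * pi x).
  apply: (rsum_cvg spi1).
  - by apply: nearW => n x; exact: FlnF.
  - by move=> x; rewrite lerDl ltW.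
  - move=> x; apply: cvgM; last exact: cvg_cst.
    have h := clip_cvg (f0 x).
    by apply: cvgM => //; apply: continuous_cvg => //; exact: continuous_ln.
have cl : A n - c n * ln (c n) @[n --> \oo] --> rsum (fun x => f x * ln (f x) * pi
  x) - 1 * ln 1.
  apply: cvgB => //; apply: cvgM => //.
  by apply: continuous_cvg => //; exact: continuous_ln.
rewrite ln1 mulr0 subr0 in cl.
by apply: (cvgr_to_le cl); apply: nearW => n; exact: main.
Qed.

End log_sobolev.

Theorem corollary3p5 (R : realType) (X : countType) (k : X -> X -> R)
  (d : measure_display) (Omega : measurableType d)
  (Pr : X -> probability Omega R)
  (Y : nat -> Omega -> X) (S : nat -> Omega -> R)
  (pi : X -> R) (kappa : R)
  (k_rates : transition_rates k)
  (k_irr : irreducible_rates k)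
  (chainP : is_markov_chain k Pr Y S)
  (pi_prob : probability_density pi)
  (pi_inv : invariant_density Pr Y S pi)
  (pi_db : detailed_balance k pi)
  (M1_fin : forall x, (M1 k x < +oo)%E)
  (M2_fin : forall x, (M2 k x < +oo)%E)
  (Pt1 : non_explosive Pr Y S)
  (kappa_gt0 : 0 < kappa)
  (CD : CD_Upsilon k kappa)
  (M1_l2 : in_lp pi 2 (M1 k))
  (M2_l1 : in_lp pi 1 (M2 k)) :
  (forall f : X -> R, P_star pi f -> (entropy pi f < +oo)%E ->
    (entropy pi f <= ((2 * kappa)^-1)%:E * Fisher_information pi k f)%E) /\
  (forall f : X -> R, P_star_plus pi f -> forall t : R, 0 < t ->
    (entropy pi (semigroup Pr Y S t f) <=
       (expR (- (2 * kappa * t)))%:E * entropy pi f)%E).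
Proof.
split=> [f|f [[f0 fpi] [M [_ fM]] finf] t t0].
  exact: (log_sobolev k_rates k_irr chainP pi_prob pi_db M1_fin M2_fin Pt1 kappa_gt0 CD M1_l2).
(* Boundedness is given for every constant strictly above M, hence M + 1. *)
have fb x : f x <= M + 1.
  apply: le_trans (ler_norm _) _; apply: fM => //; by rewrite ltrDl.
have fa x : inf (range f) <= f x.
  apply: ge_inf; last by exists x.
  by exists 0 => _ [y _ <-]; exact: ltW.
have p0 x : 0 <= f x * pi x by rewrite mulr_ge0// ltW//; exact: pi_gt0 pi_prob x.
have mass : rsum (fun x => f x * pi x) = 1.
  by rewrite /rsum rsum_ge0E// fpi.
exact: (entropy_decay_bounded k_rates k_irr chainP pi_prob pi_db M1_fin M2_fin Pt1
  kappa_gt0 CD M1_l2 finf fa fb mass (ltW t0)).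
Qed.
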